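(* Let $F\in\mathbb{Q}[x,y]$ satisfy: $F(\mathbb{R}\times\mathbb{R})=\mathbb{R}$; for all but finitely many $c\in\mathbb{C}$ the curve $F(x,y)=c$ is smooth and isomorphic to $\mathbb{A}^1_*$; the curve $C=\{F(x,y)=0\}$ is smooth and isomorphic over $\overline{\mathbb{Q}}$ to $\mathbb{A}^1_*$, via $\phi:\mathbb{P}^1\setminus\{a,b\}\to C$ with $a,b\in\mathbb{P}^1(\mathbb{R})$. Let $\tilde\phi:\mathbb{P}^1\to\mathbb{P}^2$ be the extension of $\phi$ to $\mathbb{P}^1$, where $\mathbb{A}^2\subset\mathbb{P}^2$ is the standard compactification. If $\tilde\phi(a)\neq\tilde\phi(b)$, then the set $\{(x,y)\in\mathbb{Q}^2 : F(x,y)<0\}$ satisfies the weak approximation property.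
   Context: $\mathbb{A}^1_*=\mathbb{A}^1\setminus\{0\}$. A set $R\subset\mathbb{Q}^2$ satisfies the weak approximation property if for every $(x_0,y_0)\in\mathbb{Q}^2$ and every positive integer $N$ there exists $(x,y)\in R$ with $x-x_0\in N\mathbb{Z}$ and $y-y_0\in N\mathbb{Z}$. *)

(* Defs.v *)
From HB Require Import structures.
From mathcomp Require Import all_boot all_order all_algebra.
From mathcomp Require Import algC.
From mathcomp Require Import complex.
From mathcomp Require Import reals.

Set Implicit Arguments.
Unset Strict Implicit.
Unset Printing Implicit Defensive.

Import Order.TTheory GRing.Theory Num.Theory.
Local Open Scope ring_scope.

(* Bivariate polynomials: G : {poly {poly K}}; the inner variable is x,
   the outer variable is y, i.e. G = \sum_j G_j(x) y^j. *)
Definition ev2 (K : comNzRingType) (G : {poly {poly K}}) (x y : K) : K :=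
  (map_poly (fun p : {poly K} => p.[x]) G).[y].

Definition polyQ2 (K : fieldType) (F : {poly {poly rat}}) : {poly {poly K}} :=
  map_poly (map_poly (fun q : rat => ratr q)) F.

Definition dX (K : comNzRingType) (G : {poly {poly K}}) : {poly {poly K}} :=
  map_poly (fun p : {poly K} => p^`()) G.
Definition dY (K : comNzRingType) (G : {poly {poly K}}) : {poly {poly K}} := G^`().

Definition smooth_fiber (K : fieldType) (G : {poly {poly K}}) (c : K) : Prop :=
  forall x y, ev2 G x y = c -> ~ (ev2 (dX G) x y = 0 /\ ev2 (dY G) x y = 0).

(* The affine curve {G(x,y) = c} over an algebraically closed field K is
   isomorphic to A^1-{0} = Spec K[t,t^-1]:
   - a morphism A^1-{0} -> curve is a pair of Laurent polynomials
     t |-> (P(t)/t^n, Q(t)/t^n);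
   - a morphism curve -> A^1-{0} is (the restriction of) a polynomial u(x,y)
     which does not vanish on the curve;
   - the two are mutually inverse. *)
Definition iso_Gm_fiber (K : fieldType) (G : {poly {poly K}}) (c : K) : Prop :=
  exists (u : {poly {poly K}}) (P Q : {poly K}) (n : nat),
    (forall t : K, t != 0 ->
       ev2 G (P.[t] / t ^+ n) (Q.[t] / t ^+ n) = c /\
       ev2 u (P.[t] / t ^+ n) (Q.[t] / t ^+ n) = t) /\
    (forall x y : K, ev2 G x y = c ->
       ev2 u x y != 0 /\
       P.[ev2 u x y] / (ev2 u x y) ^+ n = x /\
       Q.[ev2 u x y] / (ev2 u x y) ^+ n = y).

(* Binary forms of degree d: g = \sum_i g_i X^i encodes
   G(s,t) = \sum_(i <= d) g_i s^i t^(d-i). *)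
Definition hev (K : comNzRingType) (d : nat) (g : {poly K}) (s t : K) : K :=
  \sum_(i < d.+1) g`_i * s ^+ i * t ^+ (d - i).

(* Proportionality of nonzero vectors in K^2 / K^3 (equality of points of
   projective space). *)
Definition prop2 (K : fieldType) (p q : K * K) : Prop :=
  exists2 l : K, l != 0 & q = (l * p.1, l * p.2).
Definition prop3 (K : fieldType) (p q : K * K * K) : Prop :=
  exists2 l : K, l != 0 & q = (l * p.1.1, l * p.1.2, l * p.2).

(* Points of P^1(K): nonzero pairs up to proportionality. *)
Definition nz2 (K : fieldType) (p : K * K) : Prop := p <> (0, 0).

(* The curve {G = 0} over K (algebraically closed) is isomorphic to
   P^1 \ {a, b} via phi, and phi~ : P^1 -> P^2 is the extension of phi.
   The morphism phi~ is given by three binary forms g0, g1, g2 of the same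
   degree d without common zero on P^1 (this representation of a morphism
   P^1 -> P^2 is unique up to a scalar); here P^2 has homogeneous
   coordinates (z : x : y) and A^2 = {z <> 0}, so that
   phi(p) = (g1(p)/g0(p), g2(p)/g0(p)).
   The inverse morphism curve -> P^1 \ {a,b} is written as
   (x,y) |-> [a - u(x,y) b] for a polynomial u not vanishing on the curve;
   this is the composition of a unit u of the coordinate ring (a morphism to
   A^1-{0}) with the isomorphism A^1-{0} -> P^1\{a,b}, w |-> [a - w b]. *)
Definition phi_iso (K : fieldType) (G : {poly {poly K}}) (a b : K * K)
    (d : nat) (g0 g1 g2 : {poly K}) (u : {poly {poly K}}) : Prop :=
  (* no common zero: phi~ is a morphism P^1 -> P^2 *)
  (forall s t : K, nz2 (s, t) ->
     ~ [/\ hev d g0 s t = 0, hev d g1 s t = 0 & hev d g2 s t = 0]) /\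
  (forall s t : K, nz2 (s, t) -> ~ prop2 a (s, t) -> ~ prop2 b (s, t) ->
     let x := hev d g1 s t / hev d g0 s t in
     let y := hev d g2 s t / hev d g0 s t in
     [/\ hev d g0 s t != 0, ev2 G x y = 0, ev2 u x y != 0 &
         prop2 (s, t) (a.1 - ev2 u x y * b.1, a.2 - ev2 u x y * b.2)]) /\
  (forall x y : K, ev2 G x y = 0 ->
     let w := ev2 u x y in
     let s := a.1 - w * b.1 in
     let t := a.2 - w * b.2 in
     [/\ w != 0, hev d g0 s t != 0,
         hev d g1 s t / hev d g0 s t = x & hev d g2 s t / hev d g0 s t = y]).

Definition in_NZ (N : nat) (q : rat) : Prop := exists k : int, q = (N%:Z * k)%:~R.
Definition weak_approx (S : rat -> rat -> Prop) : Prop :=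
  forall (x0 y0 : rat) (N : nat), (0 < N)%N ->
    exists x y : rat, S x y /\ in_NZ N (x - x0) /\ in_NZ N (y - y0).

(* Main.v *)
Require Import Defs.
From HB Require Import structures.
From mathcomp Require Import all_boot all_order all_algebra.
From mathcomp Require Import algC complex reals.
From mathcomp Require Import zify ring lra polyrcf boolp.
Import Order.TTheory GRing.Theory Num.Theory.
Local Open Scope ring_scope.

(* Let F_D be the top degree form of F. If F_D is negative in some real
   direction, then F < 0 on a thick cone, which meets every residue class.
   Otherwise F_D >= 0 on R^2, and this contradicts the hypotheses, as follows.
   The two ends of C are distinct zeros of F_D at infinity. A curve F = c
   isomorphic to G_m accumulates at infinity at every zero of F_D, and only along
   its two ends; so F_D has exactly two projective zeros, which are the directions
   of the ends of each such curve. F_D has a real zero (otherwise F would be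
   bounded below), hence both zeros v, w are real. For c real, a real point of
   F = c lies on a real branch joining the two ends, since complex conjugation on
   G_m cannot exchange them. This branch crosses one of the lines R(v + w) and
   R(v - w), where F_D > 0 away from the origin and F is therefore bounded below:
   impossible for c very negative. *)

Set Implicit Arguments.
Unset Strict Implicit.
Unset Printing Implicit Defensive.

(** * Homogeneous parts *)

(** Three fields meet: C is parametrized over [algC], the generic fibers over [R[i]], and the
    inequalities live in [R]. No embedding of [algC] into [R[i]] is used; only the existence of two
    distinct zeros of F_D crosses over, through its rational coefficients. Limits are replaced by
    explicit inequalities and by polynomial identities evaluated at 0. A fiber isomorphic to G_m is
    written t |-> (A/t^e, B/t^e) with poles at 0 and at infinity, so its ends have directions (A(0)
    : B(0)) and (A_d : B_d). That every zero of F_D is such a direction comes from a perturbation of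
    roots: at distance s, F = c is a polynomial equation in the slope h (measured from the zero)
    whose constant term is O(s^(D-1)), while some other coefficient grows like s^D. So it has a root
    h near 0, and the parameter t of that point cannot stay in an annulus where the curve is
    bounded. The second zero w is real since otherwise v, w and its conjugate would be three zeros.
    Both lines R(v + w) and R(v - w) are needed because a projective direction does not say whether
    the branch escapes along w or along -w. *)

Lemma hev_homog (K : comNzRingType) k (g : {poly K}) (l s t : K) :
  hev k g (l * s) (l * t) = l ^+ k * hev k g s t.
Proof.
rewrite /hev big_distrr; apply: eq_bigr => i _ /=.
have <- : l ^+ i * l ^+ (k - i) = l ^+ k.
  by rewrite -exprD subnKC // -ltnS ltn_ord.
rewrite !exprMn; ring.
Qed.

Lemma rmorph_hev (K L : comNzRingType) (phi : {rmorphism K -> L}) k g s t :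
  phi (hev k g s t) = hev k (map_poly phi g) (phi s) (phi t).
Proof.
rewrite /hev rmorph_sum; apply: eq_bigr => i _ /=.
by rewrite !rmorphM !rmorphXn coef_map.
Qed.

Lemma horner_hev (K : comNzRingType) k (g A B : {poly K}) t :
  (hev k (map_poly polyC g) A B).[t] = hev k g A.[t] B.[t].
Proof.
rewrite /hev horner_sum; apply: eq_bigr => i _.
by rewrite !hornerM !horner_exp coef_map hornerC.
Qed.

Lemma hev1r (K : comNzRingType) k (g : {poly K}) s :
  (size g <= k.+1)%N -> hev k g s 1 = g.[s].
Proof.
move=> sg; rewrite (horner_coef_wide _ sg); apply: eq_bigr => i _.
by rewrite expr1n mulr1.
Qed.

Lemma hev0r (K : comNzRingType) k (g : {poly K}) s : hev k g s 0 = g`_k * s ^+ k.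
Proof.
rewrite /hev (bigD1 ord_max) //= subnn mulr1 big1 ?addr0 // => i.
rewrite -val_eqE /= => ik; rewrite expr0n subn_eq0 leqNgt ltn_neqAle ik.
by rewrite (ltnSE (ltn_ord i)) mulr0.
Qed.

(** The outer index is the power of y, so position i holds the coefficient of x^i y^(k - i): the
    encoding of binary forms that [hev k] evaluates. *)
Definition hpart (K : comNzRingType) (G : {poly {poly K}}) (k : nat) : {poly K} :=
  \poly_(i < k.+1) G`_(k - i)`_i.

Definition hsum (K : comNzRingType) (D : nat) (f : nat -> {poly K}) (x y : K) : K :=
  \sum_(k < D.+1) hev k (f k) x y.

Lemma size_hpart (K : comNzRingType) (G : {poly {poly K}}) k :
  (size (hpart G k) <= k.+1)%N.
Proof. exact: size_poly. Qed.

Lemma ev2_coef (K : comNzRingType) (G : {poly {poly K}}) m x y :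
  (size G <= m)%N -> (forall j, (size (G`_j)%R <= m)%N) ->
  ev2 G x y = \sum_(j < m) \sum_(i < m) G`_j`_i * x ^+ i * y ^+ j.
Proof.
move=> sG sGj; rewrite /ev2.
rewrite (@horner_coef_wide _ m); last exact: leq_trans (size_poly _ _) sG.
apply: eq_bigr => j _; rewrite coef_map_id0 ?horner0 //.
by rewrite (horner_coef_wide _ (sGj j)) mulr_suml.
Qed.

(** The square i, j < m lies inside the triangle i + j < 2m, and [T] is zero on the rest of it. This
    groups the monomials by total degree. *)
Lemma sum_triangle (V : nmodType) (T : nat -> nat -> V) m :
  (forall i j, (m <= i)%N || (m <= j)%N -> T i j = 0) ->
  \sum_(k < m + m) \sum_(i < k.+1) T i (k - i)%N =
  \sum_(i < m) \sum_(j < m) T i j.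
Proof.
move=> T0.
transitivity (\sum_(k < m + m) \sum_(i < m + m | (i < k.+1)%N) T i (k - i)%N).
  apply: eq_bigr => k _.
  by rewrite -(big_ord_widen _ (fun i => T i (k - i)%N)).
rewrite (exchange_big_dep xpredT) //=.
transitivity (\sum_(i < m + m) \sum_(j < m + m - i) T i j).
  apply: eq_bigr => i _.
  rewrite -(big_mkord xpredT (T i)).
  rewrite -(@big_geq_mkord _ _ _ i (m + m) xpredT (fun k => T i (k - i)%N)) /=.
  rewrite -{1}[nat_of_ord i]add0n big_addn.
  by apply: eq_bigr => j _; rewrite addnK.
rewrite big_split_ord /= [X in _ + X]big1 ?addr0 => [|i _]; last first.
  by rewrite big1 // => j _; rewrite T0 // leq_addr.
apply: eq_bigr => i _.
have le_m : (m <= m + m - i)%N by have := ltn_ord i; lia.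
rewrite (big_ord_widen _ (T i) le_m) [LHS](bigID (fun j : 'I__ => (j < m)%N)) /=.
rewrite [X in _ + X]big1 ?addr0 // => j; rewrite -leqNgt => mj.
by rewrite T0 ?mj ?orbT.
Qed.

Lemma ev2_hsum (K : comNzRingType) (G : {poly {poly K}}) :
  exists M, forall m, (M <= m)%N ->
    hpart G m = 0 /\ (forall x y, ev2 G x y = hsum m (hpart G) x y).
Proof.
pose m0 := (maxn (size G) (\max_(j < size G) size (G`_j)%R)).+1.
have sG : (size G < m0)%N by rewrite /m0 ltnS leq_maxl.
have sGj j : (size (G`_j)%R < m0)%N.
  case: (ltnP j (size G)) => [lt_j|/(nth_default 0)->]; last by rewrite size_poly0.
  rewrite /m0 ltnS leq_max; apply/orP; right.
  exact: (leq_bigmax (Ordinal lt_j)).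
have G0 i j : (m0 <= i)%N || (m0 <= j)%N -> G`_j`_i = 0.
  case/orP => le_m.
    by apply: nth_default; apply: leq_trans le_m; apply: ltnW.
  by rewrite [G`_j]nth_default ?coef0 //; apply: leq_trans le_m; apply: ltnW.
have hp0 m : (m0 + m0 <= m)%N -> hpart G m = 0.
  move=> lem; apply/polyP=> i; rewrite coef_poly coef0; case: ifP => // im.
  by apply: G0; lia.
exists (m0 + m0)%N => m lem; split=> [|x y]; first exact: hp0.
rewrite (@ev2_coef _ _ m0) ?(ltnW sG) // => [|j]; last exact: ltnW.
rewrite exchange_big /=.
rewrite -(@sum_triangle _ (fun i j => G`_j`_i * x ^+ i * y ^+ j)); last first.
  by move=> i j /G0->; rewrite !mul0r.
rewrite /hsum (big_ord_widen _ (fun k => \sum_(i < k.+1)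
  G`_(k - i)`_i * x ^+ i * y ^+ (k - i)) (leqW lem)).
rewrite [RHS](bigID (fun k : 'I__ => (k < m0 + m0)%N)) /= [X in _ + X]big1 ?addr0.
  apply: eq_bigr => k _; apply: eq_bigr => i _.
  by rewrite coef_poly ltn_ord.
move=> k; rewrite -leqNgt => /hp0->.
by rewrite /hev big1 // => i _; rewrite coef0 !mul0r.
Qed.

(** * The ends of a parametrized curve *)

(** The integers 1, 2, ... already give more roots than the degree allows. Positive t are the
    convenient test points: t = 0 is a pole of the parametrizations, and positive elements are fixed
    by conjugation. *)
Lemma poly_eq_pos (K : numDomainType) (p q : {poly K}) :
  (forall t, 0 < t -> p.[t] = q.[t]) -> p = q.
Proof.
move=> pq; apply/eqP; rewrite -subr_eq0; apply/eqP.
pose rs := [seq i.+1%:R : K | i <- iota 0 (size (p - q))].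
apply: (@roots_geq_poly_eq0 _ _ rs); last by rewrite size_map size_iota.
  apply/allP=> _ /mapP[i _ ->].
  by rewrite rootE hornerD hornerN pq ?subrr ?ltr0Sn.
by rewrite map_inj_uniq ?iota_uniq // => i j /eqP; rewrite eqr_nat => /eqP[].
Qed.

Lemma hpart_polyQ2 (K : numFieldType) (F : {poly {poly rat}}) k :
  hpart (polyQ2 K F) k = map_poly ratr (hpart F k).
Proof.
apply/polyP=> i; rewrite [LHS]coef_poly [RHS]coef_map /= [in RHS]coef_poly.
case: ifP => _; last by rewrite raddf0.
by rewrite /polyQ2 coef_map_id0 ?coef_map_id0 ?raddf0 //.
Qed.

Section Laurent.
Variable K : numFieldType.
Implicit Types (A B : {poly K}) (f : nat -> {poly K}).

(** The numerator of F(A/t^e, B/t^e) over t^(e D). The part of degree k carries the factor t^(e (D -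
    k)), so for e > 0 only the top form survives at t = 0. *)
Definition hsum_numer D f A B e : {poly K} :=
  \sum_(k < D.+1) 'X^(e * (D - k)) * hev k (map_poly polyC (f k)) A B.

Lemma horner_hsum_numer D f A B e t : t != 0 ->
  (hsum_numer D f A B e).[t] =
  hsum D f (A.[t] / t ^+ e) (B.[t] / t ^+ e) * t ^+ (e * D).
Proof.
move=> t0; rewrite /hsum_numer horner_sum /hsum mulr_suml; apply: eq_bigr => k _.
rewrite hornerM hornerXn horner_hev ![_.[t] / _]mulrC hev_homog.
have kD : (k <= D)%N by rewrite -ltnS.
have -> : t ^+ (e * D) = t ^+ (e * (D - k)) * (t ^+ e) ^+ k.
  by rewrite -exprM -exprD -mulnDr subnK.
rewrite exprVn; have : (t ^+ e) ^+ k != 0 by rewrite !expf_neq0.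
by move=> nz; rewrite mulrAC -[RHS]mulrA; field.
Qed.

Lemma hsum_numer_at0 D f A B e : (0 < e)%N ->
  (hsum_numer D f A B e).[0] = hev D (f D) A.[0] B.[0].
Proof.
move=> e0; rewrite /hsum_numer horner_sum (bigD1 ord_max) //= subnn muln0 mul1r.
rewrite horner_hev big1 ?addr0 // => k kD.
have {}kD : (0 < D - k)%N.
  by rewrite subn_gt0 ltn_neqAle -ltnS ltn_ord andbT.
by rewrite hornerM hornerXn expr0n gtn_eqF ?mul0r // muln_gt0 e0.
Qed.

Lemma horner_hsum_numer0 D f A B t :
  (hsum_numer D f A B 0).[t] = hsum D f A.[t] B.[t].
Proof.
rewrite /hsum_numer horner_sum /hsum; apply: eq_bigr => k _.
by rewrite mul0n mul1r horner_hev.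
Qed.

(** On the curve the numerator is c t^(e D), which vanishes at t = 0. *)
Lemma top_form_end D f A B e c : (0 < D)%N -> (0 < e)%N ->
  (forall t, t != 0 -> hsum D f (A.[t] / t ^+ e) (B.[t] / t ^+ e) = c) ->
  hev D (f D) A.[0] B.[0] = 0.
Proof.
move=> D0 e0 Fc; rewrite -(hsum_numer_at0 _ _ _ _ e0).
have -> : hsum_numer D f A B e = c *: 'X^(e * D).
  apply: poly_eq_pos => t /gt_eqF/negbT t0.
  by rewrite horner_hsum_numer // Fc // hornerZ hornerXn.
by rewrite hornerZ hornerXn expr0n gtn_eqF ?mulr0 // muln_gt0 e0.
Qed.

(** If e = 0, the parametrization extends to t = 0, where F = c still holds while the unit
    [hsum E h], which equals t, takes the value 0. *)
Lemma pole_at_zero D f E h A B e c :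
  (forall x y, hsum D f x y = c -> hsum E h x y != 0) ->
  (forall t, t != 0 -> hsum D f (A.[t] / t ^+ e) (B.[t] / t ^+ e) = c /\
                       hsum E h (A.[t] / t ^+ e) (B.[t] / t ^+ e) = t) ->
  (0 < e)%N.
Proof.
case: e => // u0 Fu; have : hsum D f A.[0] B.[0] = c.
  rewrite -horner_hsum_numer0 -[RHS](hornerC c 0); congr (_.[_]).
  apply: poly_eq_pos => t /gt_eqF/negbT t0.
  by rewrite horner_hsum_numer // mul0n mulr1 (Fu _ t0).1 hornerC.
move/u0; rewrite -horner_hsum_numer0.
have -> : hsum_numer E h A B 0 = 'X.
  apply: poly_eq_pos => t /gt_eqF/negbT t0.
  by rewrite horner_hsum_numer // mul0n mulr1 (Fu _ t0).2 hornerX.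
by rewrite hornerX eqxx.
Qed.

(** If e = 0, then 1/t would be a polynomial in t. Applied in the inverse coordinate, this gives the
    pole at the other end. *)
Lemma pole_at_infty E h A B e :
  (forall t, t != 0 -> hsum E h (A.[t] / t ^+ e) (B.[t] / t ^+ e) = t^-1) ->
  (0 < e)%N.
Proof.
case: e => // ut; have /(congr1 (horner^~ 0)) : hsum_numer E h A B 0 * 'X = 1.
  apply: poly_eq_pos => t /gt_eqF/negbT t0.
  by rewrite hornerM horner_hsum_numer // mul0n mulr1 ut // hornerX hornerC mulVf.
by rewrite hornerM hornerX mulr0 hornerC => /esym/eqP; rewrite oner_eq0.
Qed.

End Laurent.

(** This is the description of the units of K[t, 1/t], after clearing denominators. *)
Lemma poly_no_root_monomial (K : closedFieldType) (p : {poly K}) :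
  (forall t, t != 0 -> p.[t] != 0) ->
  exists (k : K) (e : nat), k != 0 /\ p = k *: 'X^e.
Proof.
move=> p0; have [r Dp] := closed_field_poly_normal p.
have nzp : lead_coef p != 0.
  rewrite lead_coef_eq0; apply/eqP => pz.
  by have := p0 1 (oner_neq0 _); rewrite pz horner0 eqxx.
exists (lead_coef p), (size r); split=> //.
rewrite [LHS]Dp; congr (_ *: _).
have r0 z : z \in r -> z = 0.
  move=> zr; have : root (lead_coef p *: \prod_(z <- r) ('X - z%:P)) z.
    by rewrite rootZ // root_prod_XsubC.
  by rewrite -Dp => pz; apply/eqP; apply: contraLR pz => /p0; rewrite rootE.
elim: r r0 {Dp} => [|z r IH] r0 /=; first by rewrite big_nil.
rewrite big_cons IH => [|w wr]; last by apply: r0; rewrite inE wr orbT.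
by rewrite (r0 z) ?inE ?eqxx // subr0 -exprS.
Qed.

Lemma det0_colinear (K : fieldType) (p1 p2 q1 q2 : K) :
  (p1, p2) <> (0, 0) -> (q1, q2) <> (0, 0) -> p1 * q2 = p2 * q1 ->
  exists2 l, l != 0 & (q1 = l * p1) /\ (q2 = l * p2).
Proof.
move=> p0 q0 det; have [p10|p10] := eqVneq p1 0.
  have p20 : p2 != 0 by apply/eqP => p20; apply: p0; rewrite p10 p20.
  have q10 : q1 = 0.
    by apply/eqP; have /eqP := det; rewrite p10 mul0r eq_sym mulf_eq0 (negPf p20).
  exists (q2 / p2); last by rewrite p10 q10 mulr0 divfK.
  rewrite mulf_neq0 ?invr_eq0 //; apply/eqP => q20.
  by apply: q0; rewrite q10 q20.
have Dq2 : q2 = q1 / p1 * p2 by rewrite mulrAC [q1 * _]mulrC -det mulrC mulKf.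
exists (q1 / p1); last by rewrite divfK.
rewrite mulf_neq0 ?invr_eq0 //; apply/eqP => q10.
by apply: q0; rewrite Dq2 q10 !mul0r.
Qed.

(** Pulled back along w |-> a - w b, [g0] has no zero for w != 0, so it is k w^e and phi becomes a
    Laurent parametrization whose end w = 0 has direction (g1(a) : g2(a)). The same with b - w a
    gives the other end. *)
Lemma phi_iso_top_form_zeros (K : numClosedFieldType) (G : {poly {poly K}}) D a b d
    g0 g1 g2 u :
  (0 < D)%N -> (forall x y, ev2 G x y = hsum D (hpart G) x y) ->
  nz2 a -> nz2 b -> ~ prop2 a b -> phi_iso G a b d g0 g1 g2 u ->
  ~ prop3 (hev d g0 a.1 a.2, hev d g1 a.1 a.2, hev d g2 a.1 a.2)
          (hev d g0 b.1 b.2, hev d g1 b.1 b.2, hev d g2 b.1 b.2) ->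
  exists p1 p2 q1 q2, [/\ p1 * q2 != p2 * q1,
    hev D (hpart G D) p1 p2 = 0 & hev D (hpart G D) q1 q2 = 0].
Proof.
case: a b => a1 a2 [b1 b2] D0 GE nza nzb nab [nocom [phiC Cphi]] /=.
have det : a1 * b2 != a2 * b1.
  apply/eqP => /(det0_colinear nza nzb)[l l0 [lb1 lb2]].
  by apply: nab; exists l; rewrite //= -lb1 -lb2.
have indep s t : s * a1 = t * b1 -> s * a2 = t * b2 -> s = 0 /\ t = 0.
  move=> e1 e2; have nd : a1 * b2 - a2 * b1 != 0 by rewrite subr_eq0.
  split; apply: (mulIf nd); rewrite mul0r.
    transitivity (s * a1 * b2 - s * a2 * b1); first by ring.
    by rewrite e1 e2; ring.
  transitivity (a1 * (t * b2) - a2 * (t * b1)); first by ring.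
  by rewrite -e1 -e2; ring.
pose lin c1 c2 : {poly K} := c1%:P - c2 *: 'X.
pose pull g c c' : {poly K} :=
  hev d (map_poly polyC g) (lin c.1 c'.1) (lin c.2 c'.2).
have pullE g c c' t : (pull g c c').[t] = hev d g (c.1 - t * c'.1) (c.2 - t * c'.2).
  by rewrite horner_hev /lin !hornerE ![_ * t]mulrC.
have [E /(_ E (leqnn E))[_ uE]] := ev2_hsum u.
(* By [indep], a - w b is a nonzero vector proportional neither to a nor to b, so phi is defined
   there; its proportionality with a - u b then forces the factor 1 and u = w. *)
have paramA w : w != 0 -> exists x y : K, [/\
    hev d g0 (a1 - w * b1) (a2 - w * b2) != 0,
    x = hev d g1 (a1 - w * b1) (a2 - w * b2) / hev d g0 (a1 - w * b1) (a2 - w * b2),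
    y = hev d g2 (a1 - w * b1) (a2 - w * b2) / hev d g0 (a1 - w * b1) (a2 - w * b2),
    ev2 G x y = 0 & ev2 u x y = w].
  move=> w0; have [|||] := phiC (a1 - w * b1) (a2 - w * b2).
  - case=> /eqP; rewrite subr_eq0 => /eqP e1 /eqP; rewrite subr_eq0 => /eqP e2.
    have [] := @indep 1 w; rewrite ?mul1r // => /eqP; by rewrite oner_eq0.
  - case=> l l0 /= [e1 e2]; have [] := @indep (1 - l) w.
    + by rewrite mulrBl mul1r -e1; ring.
    + by rewrite mulrBl mul1r -e2; ring.
    + by move=> _ /eqP; rewrite (negPf w0).
  - case=> l l0 /= [e1 e2]; have [] := @indep 1 (l + w).
    + by rewrite mulrDl mul1r -e1; ring.
    + by rewrite mulrDl mul1r -e2; ring.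
    + by move=> /eqP; rewrite oner_eq0.
  move=> g00 Gxy uxy [l l0 /= [e1 e2]].
  set x := _ / _ in Gxy uxy e1 e2; set y := _ / hev d g0 _ _ in Gxy uxy e1 e2.
  exists x, y; split=> //.
  have [] := @indep (1 - l) (ev2 u x y - l * w).
  + transitivity ((a1 - ev2 u x y * b1) - l * a1 + ev2 u x y * b1); first by ring.
    by rewrite e1; ring.
  + transitivity ((a2 - ev2 u x y * b2) - l * a2 + ev2 u x y * b2); first by ring.
    by rewrite e2; ring.
  + move=> /eqP; rewrite subr_eq0 => /eqP <- /eqP; rewrite mul1r subr_eq0.
    by move/eqP.
(* b - w a is -w times a - w^-1 b, and the common factor cancels in g1/g0 and g2/g0. *)
have paramB w : w != 0 -> exists x y : K, [/\
    hev d g0 (b1 - w * a1) (b2 - w * a2) != 0,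
    x = hev d g1 (b1 - w * a1) (b2 - w * a2) / hev d g0 (b1 - w * a1) (b2 - w * a2),
    y = hev d g2 (b1 - w * a1) (b2 - w * a2) / hev d g0 (b1 - w * a1) (b2 - w * a2),
    ev2 G x y = 0 & ev2 u x y = w^-1].
  move=> w0; have wV : w^-1 != 0 by rewrite invr_eq0.
  have [x [y [g00 -> -> Gxy uxy]]] := paramA _ wV.
  have e1 : a1 - w^-1 * b1 = - w^-1 * (b1 - w * a1) by field.
  have e2 : a2 - w^-1 * b2 = - w^-1 * (b2 - w * a2) by field.
  rewrite e1 e2 !hev_homog in g00 Gxy uxy *.
  have nzk : (- w^-1) ^+ d != 0 by rewrite expf_neq0 // oppr_eq0.
  have nz0 : hev d g0 (b1 - w * a1) (b2 - w * a2) != 0.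
    by apply: contraNneq g00 => ->; rewrite mulr0.
  rewrite !invfM !mulrA ![_ ^+ d * hev _ _ _ _]mulrC !mulfK // in Gxy uxy *.
  by do 2!eexists; split.
have numer c c' :
    (forall w, w != 0 -> hev d g0 (c.1 - w * c'.1) (c.2 - w * c'.2) != 0) ->
    exists k e, [/\ k != 0, hev d g0 c.1 c.2 = k * 0 ^+ e & forall g w, w != 0 ->
      hev d g (c.1 - w * c'.1) (c.2 - w * c'.2) /
      hev d g0 (c.1 - w * c'.1) (c.2 - w * c'.2) =
      (k^-1 *: pull g c c').[w] / w ^+ e].
  move=> nz; have [|k [e [k0 Dg]]] := @poly_no_root_monomial _ (pull g0 c c').
    by move=> t /nz; rewrite pullE.
  exists k, e; split=> // [|g w w0].
    have := congr1 (horner^~ 0) Dg.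
    by rewrite hornerZ hornerXn pullE !mul0r !subr0.
  by rewrite -[X in _ / X]pullE Dg !hornerZ hornerXn pullE invfM; ring.
have [k [e [k0 ga0 xE]]] : exists k e, _ := numer (a1, a2) (b1, b2)
  (fun w w0 => let: ex_intro _ (ex_intro _ (And5 h _ _ _ _)) := paramA w w0 in h).
have [k' [e' [k'0 gb0 xE']]] : exists k e, _ := numer (b1, b2) (a1, a2)
  (fun w w0 => let: ex_intro _ (ex_intro _ (And5 h _ _ _ _)) := paramB w w0 in h).
rewrite /= in ga0 gb0 xE xE'.
have curveA t : t != 0 ->
    hsum D (hpart G) ((k^-1 *: pull g1 (a1, a2) (b1, b2)).[t] / t ^+ e)
                     ((k^-1 *: pull g2 (a1, a2) (b1, b2)).[t] / t ^+ e) = 0 /\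
    hsum E (hpart u) ((k^-1 *: pull g1 (a1, a2) (b1, b2)).[t] / t ^+ e)
                     ((k^-1 *: pull g2 (a1, a2) (b1, b2)).[t] / t ^+ e) = t.
  move=> t0; have [x [y [_ -> ->]]] := paramA _ t0.
  by rewrite !xE // -GE -uE.
have curveB t : t != 0 ->
    hsum D (hpart G) ((k'^-1 *: pull g1 (b1, b2) (a1, a2)).[t] / t ^+ e')
                     ((k'^-1 *: pull g2 (b1, b2) (a1, a2)).[t] / t ^+ e') = 0 /\
    hsum E (hpart u) ((k'^-1 *: pull g1 (b1, b2) (a1, a2)).[t] / t ^+ e')
                     ((k'^-1 *: pull g2 (b1, b2) (a1, a2)).[t] / t ^+ e') = t^-1.
  move=> t0; have [x [y [_ -> ->]]] := paramB _ t0.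
  by rewrite !xE' // -GE -uE.
have e0 : (0 < e)%N.
  apply: pole_at_zero curveA => x y; rewrite -GE -uE => /Cphi[] //.
have e'0 : (0 < e')%N by apply: pole_at_infty (fun t t0 => (curveB t t0).2).
have zA := top_form_end D0 e0 (fun t t0 => (curveA t t0).1).
have zB := top_form_end D0 e'0 (fun t t0 => (curveB t t0).1).
rewrite !hornerZ !pullE /= !mul0r !subr0 hev_homog in zA.
rewrite !hornerZ !pullE /= !mul0r !subr0 hev_homog in zB.
(* As e and e' are positive, [g0] vanishes at a and b: both images lie on the line at infinity, and
   their distinctness becomes a nonzero 2 x 2 determinant. *)
rewrite expr0n gtn_eqF // mulr0 in ga0; rewrite expr0n gtn_eqF // mulr0 in gb0.
have cancel m (l z : K) : l != 0 -> l^-1 ^+ m * z = 0 -> z = 0.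
  by move=> l0 /eqP; rewrite mulf_eq0 expf_eq0 invr_eq0 (negPf l0) andbF => /eqP.
move/(cancel _ _ _ k0): zA => zA; move/(cancel _ _ _ k'0): zB => zB notprop.
exists (hev d g1 a1 a2), (hev d g2 a1 a2), (hev d g1 b1 b2), (hev d g2 b1 b2).
split=> //; apply/eqP => /det0_colinear[||l l0 [lb1 lb2]].
- by case=> z1 z2; apply: (nocom _ _ nza).
- by case=> z1 z2; apply: (nocom _ _ nzb).
by apply: notprop; exists l; rewrite //= ga0 gb0 mulr0 -lb1 -lb2.
Qed.

(** * Zeros of binary forms over different fields *)

Lemma hev_div (K : fieldType) D (g : {poly K}) x y : (size g <= D.+1)%N -> y != 0 ->
  hev D g x y = y ^+ D * g.[x / y].
Proof.
move=> sg y0; rewrite -(hev1r _ sg) -hev_homog mulr1.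
by rewrite mulrC divfK.
Qed.

Lemma det0_root (K : fieldType) D (g : {poly K}) r p1 p2 q1 q2 :
  (size g <= D.+1)%N -> g`_D != 0 -> (forall z, g.[z] = 0 -> z = r) ->
  hev D g p1 p2 = 0 -> hev D g q1 q2 = 0 -> p1 * q2 = p2 * q1.
Proof.
move=> sg gD gr.
suff proj x y : hev D g x y = 0 -> x = r * y.
  by move=> /proj-> /proj->; ring.
have [->|y0] := eqVneq y 0.
  rewrite hev0r mulr0 => /eqP; rewrite mulf_eq0 (negPf gD) expf_eq0 /=.
  by case/andP=> _ /eqP.
rewrite (hev_div _ sg y0) => /eqP; rewrite mulf_eq0 expf_eq0 (negPf y0) andbF /=.
by move/eqP/gr => <-; rewrite divfK.
Qed.

(* The binary form over Q has two distinct projective zeros over one field of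
   characteristic 0 iff it is not a multiple of a power of a linear form, which
   is a condition on its rational coefficients. *)
Lemma rat_form_zeros_transfer (L : numFieldType) (K : numClosedFieldType) D
    (f : {poly rat}) (p1 p2 q1 q2 : L) :
  f != 0 -> (size f <= D.+1)%N -> p1 * q2 != p2 * q1 ->
  hev D (map_poly ratr f) p1 p2 = 0 -> hev D (map_poly ratr f) q1 q2 = 0 ->
  exists r1 r2 s1 s2 : K, [/\ r1 * s2 != r2 * s1,
    hev D (map_poly ratr f) r1 r2 = 0 & hev D (map_poly ratr f) s1 s2 = 0].
Proof.
move=> f0 sf det zp zq.
have sfL : (size (map_poly ratr f : {poly L}) <= D.+1)%N by rewrite size_map_poly.
have sfK : (size (map_poly ratr f : {poly K}) <= D.+1)%N by rewrite size_map_poly.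
(* If the coefficient of x^D vanishes, (1 : 0) is a zero; a second one is a root of [f], absent only
   when [f] is constant, that is, when the form is a multiple of y^D. *)
have [fD|fD] := eqVneq f`_D 0.
  have [sf1|sf1] := leqP (size f) 1; last first.
    have /closed_rootP[r /rootP rr] : size (map_poly ratr f : {poly K}) != 1.
      by rewrite size_map_poly gtn_eqF.
    exists 1, 0, r, 1; split; first by rewrite mulr1 mul0r oner_eq0.
      by rewrite hev0r coef_map /= fD rmorph0 mul0r.
    by rewrite hev1r.
  have zero y x : hev D (map_poly ratr f : {poly L}) x y = 0 -> y = 0.
    move=> /eqP; apply: contraTeq => y0; rewrite (hev_div _ sfL y0).
    have [a a0 ->] : exists2 a, a != 0 & f = a%:P.
      by apply/size_poly1P; rewrite eqn_leq sf1 lt0n size_poly_eq0.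
    by rewrite map_polyC hornerC mulf_neq0 ?expf_neq0 // fmorph_eq0.
  by move: det; rewrite (zero _ _ zp) (zero _ _ zq) mulr0 mul0r eqxx.
have fDL : (map_poly ratr f : {poly L})`_D != 0 by rewrite coef_map fmorph_eq0.
have sf1 : size f = D.+1.
  by apply/eqP; rewrite eqn_leq sf ltnNge; apply: contraNN fD => /leq_sizeP->.
pose g : {poly K} := map_poly ratr f.
have [rs Dg] := closed_field_poly_normal g.
have lg : lead_coef g = ratr f`_D by rewrite lead_coef_map lead_coefE sf1.
have lg0 : lead_coef g != 0 by rewrite lg fmorph_eq0.
have srs : size rs = D.
  have : size g = D.+1 by rewrite size_map_poly.
  by rewrite Dg size_scale // size_prod_XsubC => -[].
case: D => [|D] in sf zp zq sfL sfK fD fDL sf1 lg srs *.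
  move: zp; rewrite /hev big_ord1 !expr0 !mulr1 => /eqP.
  by rewrite (negPf fDL).
have grs z : z \in rs -> hev D.+1 g z 1 = 0.
  move=> zrs; rewrite hev1r // Dg; apply/eqP.
  by rewrite -/(root _ _) rootZ // root_prod_XsubC.
case: rs => // r rs in Dg srs grs *.
have [/allP rsr|/allPn[z zrs zr]] := boolP (all (pred1 r) rs); last first.
  exists r, 1, z, 1; rewrite mulr1 mul1r eq_sym zr; split=> //; apply: grs.
    by rewrite mem_head.
  by rewrite inE zrs orbT.
have Drs : r :: rs = nseq D.+1 r 
  by case: srs => <-; congr (_ :: _); apply/all_pred1P/allP.
have gE : g = lead_coef g *: ('X - r%:P) ^+ D.+1.
  rewrite {1}Dg Drs; congr (_ *: _).
  by rewrite big_nseq -Monoid.iteropE.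
(* All the D + 1 roots equal r, so their sum (D + 1) r is read off the two leading coefficients and
   r is rational. The form is then a multiple of a power of a linear form over Q, hence over L,
   where it cannot have two zeros. *)
have [rho Dr] : exists rho : rat, r = ratr rho.
  exists (- f`_D / f`_D.+1 / D.+1%:R).
  have := congr1 (fun h : {poly K} => h`_D) Dg.
  have := coefPn_prod_XsubC (ps := r :: rs) isT.
  have -> : (size (r :: rs)).-1 = D by rewrite srs.
  rewrite coefZ => -> ; rewrite Drs big_nseq lg coef_map /= => e.
  have fDK : (ratr f`_D.+1 : K) != 0 by rewrite fmorph_eq0.
  have D1 : (D.+1%:R : K) != 0 by rewrite pnatr_eq0.
  rewrite !fmorph_div rmorphN /= ratr_nat e iter_addr_0 -mulrS -mulr_natr.
  by field; rewrite /= fDK andbT addrC natr1 D1.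
exfalso; move: det; apply/negP; rewrite negbK; apply/eqP.
have fE : f = f`_D.+1 *: ('X - rho%:P) ^+ D.+1.
  apply: (map_poly_inj (ratr : {rmorphism rat -> K})).
  by rewrite [LHS]gE map_polyZ rmorphXn rmorphB /= map_polyX map_polyC lg Dr.
apply: (det0_root (r := ratr rho) sfL fDL _ zp zq) => z.
rewrite fE map_polyZ rmorphXn rmorphB /= map_polyX map_polyC.
rewrite hornerZ horner_exp !hornerE => /eqP.
by rewrite mulf_eq0 fmorph_eq0 (negPf fD) expf_eq0 subr_eq0 => /eqP.
Qed.

(** * Zeros of the top form as limits of points of a fiber *)

(** Up to sign, the coefficient of index j is a sum of at most 2^n products of n - j roots, and each
    of these is the product of all the roots divided by j roots of absolute value at least eps. *)
Lemma coef_prod_XsubC_le (K : numDomainType) (rs : seq K) (eps : K) j :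
  0 <= eps -> all (fun z => eps <= `|z|) rs ->
  `|(\prod_(z <- rs) ('X - z%:P))`_j| * eps ^+ j <=
  2 ^+ size rs * `|(\prod_(z <- rs) ('X - z%:P))`_0|.
Proof.
move=> eps0; elim: rs j => [|z rs IH] j /=.
  move=> _; rewrite big_nil mul1r !coef1.
  by case: j => [|j] /=; rewrite ?normr0 ?mul0r ?normr1 ?ler01 ?mulr1.
case/andP=> epsz /IH {}IH; rewrite big_cons.
set q := \prod_(_ <- _) _ in IH *.
have qE i : (('X - z%:P) * q)`_i = (if i == 0%N then 0 else q`_i.-1) - z * q`_i.
  by rewrite mulrBl coefB coefXM coefCM.
rewrite !qE /= sub0r normrN normrM exprS.
have bj : `|z * q`_j| * eps ^+ j <= `|z| * (2 ^+ size rs * `|q`_0|).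
  by rewrite normrM -mulrA ler_wpM2l.
have bi : `|if j == 0%N then 0 else q`_j.-1| * eps ^+ j <=
          `|z| * (2 ^+ size rs * `|q`_0|).
  case: j {bj} => [|j] /=; first by rewrite normr0 mul0r !mulr_ge0 ?exprn_ge0.
  rewrite exprS mulrCA; apply: ler_pM => //; first by rewrite mulr_ge0 ?exprn_ge0.
apply: le_trans (ler_wpM2r (exprn_ge0 _ eps0) (ler_normB _ _)) _.
rewrite mulrDl; apply: le_trans (lerD bi bj) _.
by rewrite le_eqVlt; apply/orP; left; apply/eqP; ring.
Qed.

Lemma root_near0 (K : numClosedFieldType) (p : {poly K}) E j (eps : K) :
  0 < eps -> (size p <= E.+1)%N -> 2 ^+ E * `|p`_0| < `|p`_j| * eps ^+ j ->
  exists2 h, p.[h] = 0 & `|h| < eps.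
Proof.
move=> eps0 sp lt_pj; have [rs Dp] := closed_field_poly_normal p.
have [p0|p0] := eqVneq p 0.
  by move: lt_pj; rewrite p0 !coef0 normr0 mul0r mulr0 ltxx.
have lp : lead_coef p != 0 by rewrite lead_coef_eq0.
have [all_rs|/allPn[h hrs]] := boolP (all (fun z => eps <= `|z|) rs); last first.
  rewrite -real_ltNge ?normr_real ?gtr0_real // => lt_h; exists h => //.
  by apply/rootP; rewrite Dp rootZ // ?root_prod_XsubC // -Dp.
have srs : (size rs <= E)%N.
  by move: sp; rewrite Dp size_scale // size_prod_XsubC.
have := coef_prod_XsubC_le j (ltW eps0) all_rs.
set q := \prod_(_ <- _) _ in Dp *; move=> le_q.
suff: `|p`_j| * eps ^+ j <= 2 ^+ E * `|p`_0| by move/(lt_le_trans lt_pj); rewrite ltxx.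
have pE i : p`_i = lead_coef p * q`_i by rewrite {1}Dp coefZ.
rewrite !pE !normrM -mulrA [leRHS]mulrCA; apply: ler_wpM2l => //.
apply: le_trans le_q _; apply: ler_wpM2r => //.
by rewrite ler_weXn2l // ler1n.
Qed.

(** The equation is viewed as a polynomial in h. Since [phi D] vanishes at 0, the constant
    coefficient has order at most s^(D-1), whereas a nonzero coefficient of [phi D] contributes s^D;
    [root_near0] then applies for s large. *)
Lemma perturbed_root (K : numClosedFieldType) D (phi : nat -> {poly K}) (c eps B : K) :
  (0 < D)%N -> phi D != 0 -> (phi D).[0] = 0 -> 0 < eps -> 0 <= B ->
  exists s h, [/\ B <= s, 0 < s, `|h| < eps & \sum_(k < D.+1) s ^+ k * (phi k).[h] = c].
Proof.
case: D => // D _ phiD phiD0 eps0 B0.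
have [j phij] : exists j, (phi D.+1)`_j != 0.
  by exists (size (phi D.+1)).-1; rewrite -lead_coefE lead_coef_eq0.
pose E := (\max_(k < D.+2) size (phi k))%N.
pose M i : K := \sum_(k < D.+1) `|(phi k)`_i| + `|c|.
have M0 i : 0 <= M i by rewrite addr_ge0 // sumr_ge0.
pose b : K := `|(phi D.+1)`_j| * eps ^+ j.
have b0 : 0 < b by rewrite mulr_gt0 ?normr_gt0 ?exprn_gt0.
(* With D now one less than the degree, |P_0| <= M_0 s^D and |P_j| >= (s |phi_j| - M_j) s^D. The
   last summand makes s large enough for the criterion of [root_near0]. *)
pose s : K := 1 + B + (2 ^+ E * M 0%N + M j * eps ^+ j) / b.
have num0 : 0 <= 2 ^+ E * M 0%N + M j * eps ^+ j.
  by rewrite addr_ge0 ?mulr_ge0 ?exprn_ge0 // ltW.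
have q0 : 0 <= (2 ^+ E * M 0%N + M j * eps ^+ j) / b by rewrite divr_ge0 // ltW.
have s1 : 1 <= s by rewrite /s -addrA lerDl addr_ge0.
have s0 : 0 < s := lt_le_trans ltr01 s1.
have Bs : B <= s by rewrite /s [1 + B]addrC -addrA lerDl addr_ge0.
have sb : 2 ^+ E * M 0%N + M j * eps ^+ j < s * b.
  rewrite /s [ltRHS]mulrDl divfK ?gt_eqF // ltrDr mulr_gt0 //.
  by rewrite ltr_pwDl.
pose P : {poly K} := \sum_(k < D.+2) s ^+ k *: phi k - c%:P.
have PE i : `|P`_i - s ^+ D.+1 * (phi D.+1)`_i| <= M i * s ^+ D.
  rewrite /P coefB coef_sum; under eq_bigr do rewrite coefZ.
  rewrite big_ord_recr /= coefC addrAC addrK.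
  rewrite /M mulrDl; apply: le_trans (ler_normB _ _) (lerD _ _).
    rewrite mulr_suml; apply: le_trans (ler_norm_sum _ _ _) _; apply: ler_sum => k _.
    rewrite normrM mulrC ler_wpM2l // ger0_norm ?exprn_ge0 ?(ltW s0) //.
    by rewrite ler_weXn2l // -ltnS.
  case: ifP => _; last by rewrite normr0 mulr_ge0 ?exprn_ge0 ?(ltW s0).
  by rewrite ler_peMr // exprn_ege1.
have sP : (size P <= E.+1)%N.
  apply: leq_trans (size_polyD _ _) _; rewrite geq_max size_polyN.
  rewrite (leq_trans (size_polyC_leq1 _)) // andbT.
  apply: leqW; apply: leq_trans (size_sum _ _ _) _; apply/bigmax_leqP => k _.
  by apply: leq_trans (size_scale_leq _ _) _; apply: (leq_bigmax k).
have [|h /eqP Ph hE] := @root_near0 _ P E j eps eps0 sP.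
  have Pj : (s * `|(phi D.+1)`_j| - M j) * s ^+ D <= `|P`_j|.
    rewrite mulrBl mulrAC -exprS lerBlDl -lerBlDr; apply: le_trans (PE j).
    have -> : s ^+ D.+1 * `|(phi D.+1)`_j| = `|s ^+ D.+1 * (phi D.+1)`_j|.
      by rewrite normrM ger0_norm ?exprn_ge0 ?(ltW s0).
    by rewrite distrC lerB_dist.
  have P0 : `|P`_0| <= M 0%N * s ^+ D.
    by have := PE 0%N; rewrite -(horner_coef0 (phi _)) phiD0 mulr0 subr0.
  apply: le_lt_trans (ler_wpM2l (exprn_ge0 _ (ler0n _ 2)) P0) _.
  apply: lt_le_trans (ler_wpM2r (exprn_ge0 _ (ltW eps0)) Pj).
  rewrite [ltLHS]mulrA [ltRHS]mulrAC ltr_pM2r ?exprn_gt0 //.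
  rewrite [ltRHS]mulrBl -[s * _ * _]mulrA -/b.
  by rewrite ltrBrDr.
exists s, h; split=> //; move: Ph; rewrite /P hornerD hornerN hornerC subr_eq0.
by rewrite horner_sum => /eqP <-; apply: eq_bigr => k _; rewrite hornerZ.
Qed.

(** In the chart (s, s h) if beta = 0, and (s (h + alpha / beta), s) otherwise, F = c becomes the
    equation of [perturbed_root], with h = 0 at the given zero. *)
Lemma top_form_zero_approx (K : numClosedFieldType) D (f : nat -> {poly K})
    (c alpha beta eps B : K) :
  (0 < D)%N -> (forall k, (size (f k) <= k.+1)%N) -> f D != 0 ->
  (alpha, beta) <> (0, 0) -> hev D (f D) alpha beta = 0 -> 0 < eps -> 0 <= B ->
  exists x y s, [/\ hsum D f x y = c, B <= s, s <= `|x| + `|y| &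
                    `|x * beta - y * alpha| <= eps * s].
Proof.
move=> D0 sf fD ab0 zf eps0 B0; have [b0|b0] := eqVneq beta 0.
  have a0 : alpha != 0 by apply/eqP => a0; apply: ab0; rewrite a0 b0.
  pose phi k := hev k (map_poly polyC (f k)) 1 'X.
  have phiE k h : (phi k).[h] = hev k (f k) 1 h by rewrite horner_hev hornerC hornerX.
  have phiD : phi D != 0.
    apply: contra_neq fD => phi0; apply: poly_eq_pos => t t0; rewrite horner0.
    have tn0 := gt_eqF t0; rewrite -(hev1r _ (sf D)).
    have -> : hev D (f D) t 1 = hev D (f D) (t * 1) (t * t^-1).
      by rewrite mulr1 divff // tn0.
    by rewrite hev_homog -phiE phi0 horner0 mulr0.
  have phi0 : (phi D).[0] = 0.
    have /eqP := zf; rewrite phiE b0 !hev0r mulf_eq0 expf_eq0 (negPf a0) andbF orbF.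
    by move/eqP->; rewrite mul0r.
  have [|s [h [Bs s0 hE phic]]] :=
    perturbed_root c D0 phiD phi0 (_ : 0 < eps / `|alpha|) B0.
    by rewrite divr_gt0 // normr_gt0.
  exists s, (s * h), s; split=> //.
  - rewrite -phic; apply: eq_bigr => k _.
    by rewrite -[X in hev _ _ X _]mulr1 hev_homog phiE.
  - by rewrite gtr0_norm // lerDl.
  rewrite b0 mulr0 sub0r normrN !normrM (gtr0_norm s0) -mulrA mulrC.
  by rewrite ler_pM2r // -ler_pdivlMr ?normr_gt0 // ltW.
pose phi k := f k \Po ('X + (alpha / beta)%:P).
have phiE k h : (phi k).[h] = hev k (f k) (h + alpha / beta) 1.
  by rewrite horner_comp !hornerE hev1r.
have phiD : phi D != 0.
  by rewrite comp_poly2_eq0 ?size_XaddC.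
have phi0 : (phi D).[0] = 0.
  have /eqP := zf; rewrite (hev_div _ (sf D)) // mulf_eq0 expf_eq0 (negPf b0) andbF /=.
  by move/eqP; rewrite phiE hev1r // add0r.
have [|s [h [Bs s0 hE phic]]] :=
  perturbed_root c D0 phiD phi0 (_ : 0 < eps / `|beta|) B0.
  by rewrite divr_gt0 // normr_gt0.
exists (s * (h + alpha / beta)), (s * 1), s; split=> //.
- by rewrite -phic; apply: eq_bigr => k _; rewrite hev_homog phiE.
- by rewrite mulr1 [`|s|]gtr0_norm // lerDr.
rewrite [X in `|X|](_ : _ = s * (h * beta)); last by field.
rewrite !normrM (gtr0_norm s0) mulrC.
by rewrite ler_pM2r // -ler_pdivlMr ?normr_gt0 // ltW.
Qed.

Lemma horner_bounded (K : numDomainType) (p : {poly K}) (rho : K) : 0 <= rho ->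
  exists2 M, 0 <= M & forall t, `|t| <= rho -> `|p.[t]| <= M.
Proof.
move=> rho0; elim/poly_ind: p => [|p c [M M0 IH]].
  by exists 0 => // t _; rewrite horner0 normr0.
exists (M * rho + `|c|) => [|t tr]; first by rewrite addr_ge0 ?mulr_ge0.
rewrite hornerMXaddC; apply: le_trans (ler_normD _ _) _.
by rewrite lerD2r normrM ler_pM ?IH.
Qed.

Lemma horner_near0 (K : numDomainType) (p : {poly K}) :
  exists2 M, 0 <= M & forall t, `|t| <= 1 -> `|p.[t] - p.[0]| <= M * `|t|.
Proof.
elim/poly_ind: p => [|p c _].
  by exists 0 => // t _; rewrite !horner0 subrr normr0 mul0r.
have [M M0 pM] := horner_bounded p ler01.
exists M => // t t1; rewrite !hornerMXaddC mulr0 add0r addrK normrM.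
by rewrite ler_wpM2r ?pM.
Qed.

(** * Reversal at t = infinity and normalised parametrizations of fibers *)

Definition revp (K : nzRingType) d (A : {poly K}) : {poly K} :=
  \poly_(i < d.+1) A`_(d - i).

Lemma revp_at0 (K : nzRingType) d (A : {poly K}) : (revp d A).[0] = A`_d.
Proof. by rewrite horner_coef0 coef_poly subn0. Qed.

Lemma horner_revp (K : fieldType) d (A : {poly K}) t : (size A <= d.+1)%N -> t != 0 ->
  (revp d A).[t] = t ^+ d * A.[t^-1].
Proof.
move=> sA t0; rewrite (horner_coef_wide _ sA) (@horner_coef_wide _ d.+1); last first.
  exact: size_poly.
rewrite mulr_sumr (reindex_inj rev_ord_inj); apply: eq_bigr => i _ /=.
have id : (i <= d)%N by rewrite -ltnS.
rewrite subSS coef_poly ltnS leq_subr subKn // exprVn mulrCA; congr (_ * _).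
have -> : t ^+ d = t ^+ (d - i) * t ^+ i by rewrite -exprD subnK.
by rewrite mulfK // expf_neq0.
Qed.

(** Normalised so that the poles have order e at t = 0 and d - e at infinity, both positive, and the
    ends have the well-defined directions (A(0) : B(0)) and (A_d : B_d). [U] is the inverse
    coordinate. *)
Definition Gm_param (K : fieldType) D (f : nat -> {poly K}) (c : K)
    (U : K -> K -> K) (A B : {poly K}) (e d : nat) : Prop :=
  [/\ (size A <= d.+1)%N /\ (size B <= d.+1)%N, (0 < e < d)%N,
      (A.[0], B.[0]) <> (0, 0) /\ (A`_d, B`_d) <> (0, 0),
      forall t, t != 0 -> hsum D f (A.[t] / t ^+ e) (B.[t] / t ^+ e) = c /\
                          U (A.[t] / t ^+ e) (B.[t] / t ^+ e) = t &
      forall x y, hsum D f x y = c -> U x y != 0 /\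
        A.[U x y] / U x y ^+ e = x /\ B.[U x y] / U x y ^+ e = y].

Lemma factor_Xn_pair (K : fieldType) (P Q : {poly K}) : (P, Q) <> (0, 0) ->
  exists j A B, [/\ P = A * 'X^j, Q = B * 'X^j & (A.[0], B.[0]) <> (0, 0)].
Proof.
have [n] := ubnP (size P + size Q); elim: n P Q => // n IH P Q ltn PQ0.
have [P0|P0] := eqVneq P.[0] 0; last first.
  by exists 0%N, P, Q; rewrite !mulr1; split=> // -[/eqP]; rewrite (negPf P0).
have [Q0|Q0] := eqVneq Q.[0] 0; last first.
  by exists 0%N, P, Q; rewrite !mulr1; split=> // -[_ /eqP]; rewrite (negPf Q0).
have /factor_theorem[P' DP] : root P 0 by apply/rootP.
have /factor_theorem[Q' DQ] : root Q 0 by apply/rootP.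
rewrite subr0 in DP DQ.
have PQ0' : (P', Q') <> (0, 0).
  by case=> P'0 Q'0; apply: PQ0; rewrite DP DQ P'0 Q'0 !mul0r.
have [|j [A [B [DA DB AB0]]]] := IH P' Q' _ PQ0'; last first.
  by exists j.+1, A, B; split=> //; rewrite ?DP ?DQ ?DA ?DB exprSr mulrA.
have sz (p : {poly K}) : size (p * 'X) = ((p != 0%R) + size p)%N.
  by have [->|p0] := eqVneq p 0; rewrite ?mul0r ?size_poly0 // size_mulX.
have nz : (0 < (P' != 0%R) + (Q' != 0%R))%N.
  have [P'0|//] := eqVneq P' 0; have [Q'0|//] := eqVneq Q' 0.
  by case: PQ0'; rewrite P'0 Q'0.
move: ltn nz; rewrite DP DQ !sz; move: (size P') (size Q') => m p.
by case: (P' != 0); case: (Q' != 0) => //=; lia.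
Qed.

(** A common power of t is cancelled and d is the larger of the two degrees, which makes both end
    directions nonzero. A missing pole at 0 or at infinity is excluded by [pole_at_zero] or
    [pole_at_infty], applied with exponent 0. *)
Lemma iso_Gm_fiber_param (K : numFieldType) (G : {poly {poly K}}) D c :
  (forall x y, ev2 G x y = hsum D (hpart G) x y) -> iso_Gm_fiber G c ->
  exists u A B e d, Gm_param D (hpart G) c (ev2 u) A B e d.
Proof.
move=> GE [u [P [Q [n [Gmc cGm]]]]].
have [E /(_ E (leqnn E))[_ uE]] := ev2_hsum u.
have PQ0 : (P, Q) <> (0, 0).
  case=> P0 Q0; have [_ u1] := Gmc 1 (oner_neq0 _).
  have [_ u2] := Gmc 2 (lt0r_neq0 (ltr0Sn K 1)).
  move: u1; rewrite P0 Q0 !horner0 !mul0r in u2 *; rewrite u2 => /eqP.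
  by rewrite (eqr_nat K 2 1).
have [j [A [B [DP DQ AB0]]]] := factor_Xn_pair PQ0.
have u0 x y : hsum D (hpart G) x y = c -> hsum E (hpart u) x y != 0.
  by rewrite -GE -uE => /cGm[].
have [nj|jn] := leqP n j.
  suff: (0 < 0)%N by [].
  apply: (pole_at_zero (A := A * 'X^(j - n)) (B := B * 'X^(j - n)) u0) => t t0.
  have e1 (p : {poly K}) : (p * 'X^(j - n)).[t] / t ^+ 0 = (p * 'X^j).[t] / t ^+ n.
    rewrite !hornerM !hornerXn -{2}(subnK nj) exprD divr1.
    by rewrite [p.[t] * (_ * _)]mulrA mulfK // expf_neq0.
  by rewrite !e1 -DP -DQ -GE -uE; apply: Gmc.
have e1 (p : {poly K}) t : t != 0 -> p.[t] / t ^+ (n - j) = (p * 'X^j).[t] / t ^+ n.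
  move=> t0; rewrite hornerM hornerXn -[in t ^+ n](subnK (ltnW jn)) exprD invfM.
  by rewrite [_^-1 * _]mulrC mulrA mulfK // expf_neq0.
pose d := (maxn (size A) (size B)).-1.
have AB0' : (A, B) <> (0, 0).
  by case=> A0 B0; apply: AB0; rewrite A0 B0 !horner0.
have szAB : maxn (size A) (size B) = d.+1.
  rewrite /d prednK // leq_max !lt0n !size_poly_eq0.
  by apply/orP; have [A0|] := eqVneq A 0; [right; apply/eqP => B0; apply: AB0'; rewrite A0 B0|left].
have sA : (size A <= d.+1)%N by rewrite -szAB leq_maxl.
have sB : (size B <= d.+1)%N by rewrite -szAB leq_maxr.
have param t : t != 0 ->
    hsum D (hpart G) (A.[t] / t ^+ (n - j)) (B.[t] / t ^+ (n - j)) = c /\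
    ev2 u (A.[t] / t ^+ (n - j)) (B.[t] / t ^+ (n - j)) = t.
  by move=> t0; rewrite !e1 // -DP -DQ -GE; apply: Gmc.
exists u, A, B, (n - j)%N, d; split=> //.
- rewrite subn_gt0 jn /= ltnNge; apply/negP => dn.
  suff: (0 < 0)%N by [].
  apply: (pole_at_infty (A := revp (n - j) A) (B := revp (n - j) B)
    (h := hpart u) (E := E)) => t t0.
  have tV : t^-1 != 0 by rewrite invr_eq0.
  have e2 (p : {poly K}) : (size p <= d.+1)%N ->
      (revp (n - j) p).[t] / t ^+ 0 = p.[t^-1] / t^-1 ^+ (n - j).
    move=> sp; rewrite divr1 horner_revp //; last exact: leq_trans sp _.
    by rewrite exprVn invrK mulrC.
  by rewrite !e2 // -uE; apply: (param _ tV).2.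
- split=> // -[Ad Bd].
  have [/maxn_idPr sAB|/ltnW/maxn_idPl sAB] := leqP (size A) (size B).
    have : lead_coef B = 0 by rewrite lead_coefE -sAB szAB.
    move/eqP; rewrite lead_coef_eq0 => /eqP B0.
    by move: szAB; rewrite sAB B0 size_poly0.
  have : lead_coef A = 0 by rewrite lead_coefE -sAB szAB.
  move/eqP; rewrite lead_coef_eq0 => /eqP A0.
  by move: szAB; rewrite sAB A0 size_poly0.
- by move=> x y; rewrite -GE => /cGm[nz [Px Qy]]; rewrite !e1 // -DP -DQ.
Qed.

(** * Directions of the ends and complex conjugation *)

(** One constant serves both as radius and as ratio: near 0, [psi] moves by at most M eta, and eta
    (M + MA + MB) < |psi(0)|. *)
Lemma separated_near0 (K : numFieldType) (A B psi : {poly K}) : psi.[0] != 0 ->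
  exists eta, 0 < eta <= 1 /\
    forall t, `|t| <= eta -> eta * (`|A.[t]| + `|B.[t]|) < `|psi.[t]|.
Proof.
move=> psi0; have [M M0 psiM] := horner_near0 psi.
have [MA MA0 AM] := horner_bounded A (@ler01 K).
have [MB MB0 BM] := horner_bounded B (@ler01 K).
have m0 : 0 < `|psi.[0]| by rewrite normr_gt0.
pose S := M + MA + MB; have S0 : 0 <= S by rewrite !addr_ge0.
have Sm : 0 < S + `|psi.[0]| by rewrite ltr_wpDl.
pose eta := `|psi.[0]| / (S + `|psi.[0]|).
have eta0 : 0 < eta by rewrite divr_gt0.
have eta1 : eta <= 1 by rewrite ler_pdivrMr // mul1r lerDr.
exists eta; split=> [|t tE]; first by rewrite eta0.
have t1 := le_trans tE eta1.
have lt_m : eta * S < `|psi.[0]|.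
  by rewrite -[ltRHS](divfK (lt0r_neq0 Sm)) -/eta ltr_pM2l // ltrDl.
apply: le_lt_trans (_ : eta * (MA + MB) < _).
  by rewrite ler_pM2l // lerD ?AM ?BM.
apply: lt_le_trans (_ : `|psi.[0]| - M * eta <= _).
  by rewrite ltrBrDr [M * _]mulrC -mulrDr [_ + M]addrC addrA.
rewrite lerBlDr -lerBlDl; apply: le_trans (lerB_dist _ _) _; rewrite distrC.
by apply: le_trans (psiM t t1) _; rewrite ler_wpM2l.
Qed.

(** A far point of the fiber close to the direction (alpha : beta) has |t| small or large. If
    neither end had that direction, A beta - B alpha would stay comparable to |A| + |B| there,
    against the closeness. *)
Lemma top_form_zero_end (K : numClosedFieldType) D (f : nat -> {poly K}) (c : K) U A B e d
    (alpha beta : K) :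
  (0 < D)%N -> (forall k, (size (f k) <= k.+1)%N) -> f D != 0 ->
  Gm_param D f c U A B e d ->
  (alpha, beta) <> (0, 0) -> hev D (f D) alpha beta = 0 ->
  A.[0] * beta = B.[0] * alpha \/ A`_d * beta = B`_d * alpha.
Proof.
move=> D0 sf fD [[sA sB] /andP[e0 ed] _ param paramV] ab0 zf.
pose psi := beta *: A - alpha *: B.
have psiE t : psi.[t] = A.[t] * beta - B.[t] * alpha.
  by rewrite hornerD hornerN !hornerZ ![_ * _.[t]]mulrC.
have spsi : (size psi <= d.+1)%N.
  apply: leq_trans (size_polyD _ _) _; rewrite geq_max size_polyN.
  by rewrite !(leq_trans (size_scale_leq _ _)).
have [e1|ne1] := eqVneq (A.[0] * beta) (B.[0] * alpha); first by left.
have [e2|ne2] := eqVneq (A`_d * beta) (B`_d * alpha); first by right.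
exfalso.
have psi0 : psi.[0] != 0 by rewrite psiE subr_eq0.
have psid : (revp d psi).[0] != 0.
  by rewrite revp_at0 coefB !coefZ ![_ * _`_d]mulrC subr_eq0.
have [eta [/andP[eta0 eta1] near0]] := separated_near0 A B psi0.
have [et [/andP[et0 et1] nearoo]] := separated_near0 (revp d A) (revp d B) psid.
have etV : 0 <= et^-1 by rewrite invr_ge0 ltW.
have [MA MA0 AM] := horner_bounded A etV.
have [MB MB0 BM] := horner_bounded B etV.
(* In the annulus eta < |t| <= 1/et, |x| + |y| is at most (MA + MB) / eta^e; a point beyond this
   bound has its parameter outside. *)
pose bd := (MA + MB) / eta ^+ e + 1.
have bd0 : 0 <= bd by rewrite addr_ge0 // divr_ge0 ?addr_ge0 ?exprn_ge0 // ltW.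
have [x [y [s [Fxy bds sxy xyE]]]] :=
  top_form_zero_approx c D0 sf fD ab0 zf (mulr_gt0 eta0 et0) bd0.
have [t0 [xE yE]] := paramV x y Fxy; move: (U x y) => t in t0 xE yE.
have te0 : t ^+ e != 0 by rewrite expf_neq0.
have AE : A.[t] = x * t ^+ e by rewrite -xE divfK.
have BE : B.[t] = y * t ^+ e by rewrite -yE divfK.
have sAB : s * `|t| ^+ e <= `|A.[t]| + `|B.[t]|.
  by rewrite AE BE !normrM -mulrDl normrX ler_wpM2r // exprn_ge0.
have psit : `|psi.[t]| <= eta * et * (`|A.[t]| + `|B.[t]|).
  apply: le_trans (_ : _ <= eta * et * (s * `|t| ^+ e)) _; last first.
    by rewrite ler_wpM2l // mulr_ge0 // ltW.
  rewrite psiE AE BE mulrAC [y * _ * _]mulrAC -mulrBl normrM normrX mulrA.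
  by rewrite ler_wpM2r ?exprn_ge0.
have ge0AB : 0 <= `|A.[t]| + `|B.[t]| by rewrite addr_ge0.
have [t_small|t_big] := real_leP (normr_real t) (gtr0_real eta0).
  have := lt_le_trans (near0 t t_small) psit; rewrite le_gtF //.
  by rewrite -mulrA ler_pM2l // ler_piMl.
have [t_large|t_bounded] := real_leP (normr_real t^-1) (gtr0_real et0).
  have := nearoo _ t_large; rewrite !horner_revp ?invr_eq0 // invrK.
  rewrite !normrM -mulrDr mulrCA ltr_pM2l ?normr_gt0 ?expf_neq0 ?invr_eq0 //.
  move/lt_le_trans/(_ psit); rewrite le_gtF //.
  by rewrite ler_wpM2r // ler_piMl // ltW.
have tr : `|t| <= et^-1.
  rewrite normfV in t_bounded.
  by rewrite -[`|t|]invrK lef_pV2 ?posrE ?invr_gt0 ?normr_gt0 // ltW.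
have : bd * eta ^+ e <= MA + MB.
  apply: le_trans (_ : _ <= s * `|t| ^+ e) _.
    by rewrite ler_pM ?exprn_ge0 ?lerXn2r ?nnegrE ?(ltW t_big) // ltW.
  by apply: le_trans sAB _; rewrite lerD ?AM ?BM.
rewrite /bd mulrDl mul1r divfK ?expf_neq0 ?lt0r_neq0 // gerDl.
by rewrite lt_geF // exprn_gt0.
Qed.

Definition dilp (K : nzRingType) d (l : K) (A : {poly K}) : {poly K} :=
  \poly_(i < d.+1) (A`_i * l ^+ i).

Lemma horner_dilp (K : comNzRingType) d (l : K) (A : {poly K}) t :
  (size A <= d.+1)%N -> (dilp d l A).[t] = A.[l * t].
Proof.
move=> sA; rewrite (horner_coef_wide _ sA) (@horner_coef_wide _ d.+1) ?size_poly //.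
by apply: eq_bigr => i _; rewrite coef_poly ltn_ord exprMn mulrA.
Qed.

Lemma hsum_conj (K : numClosedFieldType) D (f : nat -> {poly K}) (x y : K) :
  (forall k, map_poly Num.conj (f k) = f k) -> hsum D f x^* y^* = (hsum D f x y)^*.
Proof.
move=> fR; rewrite /hsum rmorph_sum; apply: eq_bigr => k _.
by rewrite rmorph_hev /= fR.
Qed.

(* In the coordinate [t] of G_m, complex conjugation on the real curve acts as
   [t |-> k * conj t ^ z]; a real point makes [k = 1] after rescaling, being an
   involution forces [z = 1] or [z = -1], and [z = -1] would exchange the two
   ends, whose directions are real and distinct. *)
Lemma Gm_param_real (K : numClosedFieldType) D (f : nat -> {poly K}) (c : K) u A B e d
    (x0 y0 : K) :
  (forall k, map_poly Num.conj (f k) = f k) -> c \is Num.real ->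
  Gm_param D f c (ev2 u) A B e d ->
  A.[0] * B.[0]^* = A.[0]^* * B.[0] -> A`_d * B.[0] != A.[0] * B`_d ->
  x0 \is Num.real -> y0 \is Num.real -> hsum D f x0 y0 = c ->
  exists2 t0, t0 != 0 & forall t, 0 < t ->
    A.[t0 * t] / (t0 * t) ^+ e \is Num.real /\ B.[t0 * t] / (t0 * t) ^+ e \is Num.real.
Proof.
move=> fR cR [[sA sB] _ [AB0 _] param paramV] realdir det x0R y0R Fxy0.
pose X t := A.[t] / t ^+ e; pose Y t := B.[t] / t ^+ e.
pose sg t := ev2 u (X t)^* (Y t)^*.
have onC t : t != 0 -> hsum D f (X t)^* (Y t)^* = c.
  by move=> t0; rewrite hsum_conj // (param t t0).1 (CrealP cR).
have sg0 t : t != 0 -> sg t != 0 by move=> /onC/paramV[].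
have sgX t : t != 0 -> X (sg t) = (X t)^* by move=> /onC/paramV[_ []].
have sgY t : t != 0 -> Y (sg t) = (Y t)^* by move=> /onC/paramV[_ []].
have sgK t : t != 0 -> sg (sg t) = t.
  by move=> t0; rewrite /sg sgX // sgY // !conjCK (param t t0).2.
have [E /(_ E (leqnn E))[_ uE]] := ev2_hsum u.
(* The conjugate of [sg t] is the conjugate polynomial of [u] at (X, Y), hence a Laurent polynomial
   in t without zeros: a monomial. *)
pose V := hsum_numer E (fun k => map_poly Num.conj (hpart u k)) A B e.
have VE t : t != 0 -> V.[t] = (sg t)^* * t ^+ (e * E).
  move=> t0; rewrite horner_hsum_numer // /sg uE; congr (_ * _).
  rewrite /hsum rmorph_sum; apply: eq_bigr => k _.
  by rewrite rmorph_hev /= !conjCK.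
have [|kap [k [kap0 Vk]]] := @poly_no_root_monomial _ V.
  by move=> t t0; rewrite VE // mulf_neq0 ?expf_neq0 // conjC_eq0 sg0.
pose M := (e * E)%N.
have [t00 [Xt0 Yt0]] := paramV _ _ Fxy0; pose t0 := ev2 u x0 y0.
have sgt0 : sg t0 = t0.
  by rewrite /sg /X /Y Xt0 Yt0 !(CrealP _).
have sgE t : 0 < t -> sg (t0 * t) * t ^+ M = t0 * t ^+ k.
  move=> tpos; have tn0 := lt0r_neq0 tpos.
  have tR n : (t ^+ n)^* = t ^+ n by rewrite (CrealP _) // rpredX // gtr0_real.
  apply: (can_inj (@conjCK K)); rewrite !rmorphM /= !tR.
  apply: (mulIf (expf_neq0 M t00)); rewrite -/t0.
  have := VE _ (mulf_neq0 t00 tn0); rewrite Vk hornerZ hornerXn -/t0 !exprMn -/M.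
  have := VE _ t00; rewrite Vk hornerZ hornerXn -/t0 sgt0 -/M => e0.
  rewrite mulrA e0 => e1; rewrite mulrAC -mulrA -e1; ring.
exists t0 => // t tpos; have tn0 := lt0r_neq0 tpos.
have nz2 : (2 : K) != 0 by rewrite pnatr_eq0.
have exp2_inj : injective (fun n => 2 ^+ n : K).
  by move=> m n /eqP; rewrite -!natrX eqr_nat eqn_exp2l // => /eqP.
suff fixed : sg (t0 * t) = t0 * t.
  have t0t := mulf_neq0 t00 tn0.
  by split; apply/CrealP; rewrite -?sgX -?sgY // fixed.
(* Let z = k - M, of either sign: sg (t0 t) = t0 t^z for t > 0. Since [sg] is an involution, t = 2
   gives 2^(z^2) = 2, so z is 1 or -1. *)
have zE tau : 0 < tau -> sg (t0 * 2) = t0 * tau -> 2 * tau ^+ M = tau ^+ k.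
  move=> tau0 e1; apply: (mulfI t00); rewrite -/t0 -sgE // -e1 sgK ?mulrA //.
  by rewrite mulf_neq0.
have sg2 : sg (t0 * 2) * 2 ^+ M = t0 * 2 ^+ k := sgE 2 (ltr0Sn _ 1).
have [Mk|kM] := leqP M k.
  have := zE (2 ^+ (k - M)) (exprn_gt0 _ (ltr0Sn _ 1)).
  rewrite -!exprM -exprS => /(_ _)/exp2_inj z1.
  have {z1} /z1 z1 : sg (t0 * 2) = t0 * 2 ^+ (k - M).
    apply: (mulIf (expf_neq0 M nz2)).
    by rewrite sg2 -mulrA -exprD subnK.
  have {z1} kE : k = M.+1.
    have {}z1 : ((k - M) * (k - M) = 1)%N by rewrite mulnBr -z1; lia.
    have /eqP := z1; rewrite muln_eq1 => /andP[/eqP]; lia.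
  by apply: (mulIf (expf_neq0 M tn0)); rewrite sgE // kE exprS mulrA.
exfalso; move: det; apply/negP; rewrite negbK; apply/eqP.
have MkE : M = k.+1.
  have := zE (2 ^- (M - k)); rewrite invr_gt0 exprn_gt0 ?ltr0Sn //.
  have -> : sg (t0 * 2) = t0 / 2 ^+ (M - k).
    apply: (mulIf (expf_neq0 M nz2)).
    by rewrite sg2 -{2}(subnK (ltnW kM)) exprD mulrA divfK ?expf_neq0.
  move=> /(_ isT erefl); rewrite !exprVn -!exprM => z1.
  have {}z1 : 2 ^+ (1 + (M - k) * k) = 2 ^+ ((M - k) * M) :> K.
    rewrite exprD expr1.
    have n1 := expf_neq0 ((M - k) * M) nz2; have n2 := expf_neq0 ((M - k) * k) nz2.
    by apply: (mulIf (invr_neq0 n2)); rewrite mulfK // -z1 mulrCA divff ?mulr1.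
  move/exp2_inj: z1 => z1.
  have {}z1 : ((M - k) * (M - k) = 1)%N by rewrite mulnBr -z1; lia.
  have /eqP := z1; rewrite muln_eq1 => /andP[/eqP]; lia.
have sgV s : 0 < s -> sg (t0 * s) = t0 * s^-1.
  move=> s0; have sn0 := lt0r_neq0 s0.
  apply: (mulIf (expf_neq0 M sn0)); rewrite sgE // MkE exprS; field.
  exact: sn0.
pose cj (p : {poly K}) := map_poly Num.conj p.
pose A1 := dilp d t0 A; pose B1 := dilp d t0 B.
(* Here z = -1: the parameters t0 s and t0 / s give conjugate points. Comparing their ratios A : B
   and evaluating at s = 0 makes (A_d : B_d) conjugate to the real direction (A(0) : B(0)), hence
   equal to it. *)
have cross : revp d A1 * cj B1 = cj A1 * revp d B1.
  apply: poly_eq_pos => s s0; have sn0 := lt0r_neq0 s0.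
  have sz p : (size (dilp d t0 p) <= d.+1)%N by apply: size_poly.
  rewrite /A1 /B1 !hornerM !horner_revp // !horner_dilp //.
  have cjE (p : {poly K}) : (size p <= d.+1)%N -> (cj (dilp d t0 p)).[s] = p.[t0 * s]^*.
    move=> sp; rewrite -(horner_dilp _ _ sp).
    have {1}-> : s = s^* by rewrite (CrealP _) // gtr0_real.
    by rewrite horner_map.
  rewrite !cjE //; have := sgX _ (mulf_neq0 t00 sn0); have := sgY _ (mulf_neq0 t00 sn0).
  rewrite -/t0 sgV // /X /Y !fmorph_div /=.
  set q := (t0 / s) ^+ e; set q' := ((t0 * s) ^+ e)^* => eB eA.
  have q0 : q != 0 by rewrite expf_neq0 // mulf_neq0 ?invr_eq0.
  have q'0 : q' != 0 by rewrite conjC_eq0 expf_neq0 // mulf_neq0.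
  have {}eA : A.[t0 * s^-1] = A.[t0 * s]^* / q' * q by rewrite -eA divfK.
  have {}eB : B.[t0 * s^-1] = B.[t0 * s]^* / q' * q by rewrite -eB divfK.
  by rewrite eA eB; ring.
have := congr1 (horner^~ 0) cross.
rewrite !hornerM !revp_at0 /cj.
have cj0 p : (map_poly Num.conj (dilp d t0 p)).[0] = p.[0]^*.
  by rewrite !horner_coef0 coef_map coef_poly /= mulr1.
rewrite !cj0 /A1 /B1 !coef_poly ltnSn => {}cross.
have {}cross : A`_d * B.[0]^* = A.[0]^* * B`_d.
  apply: (mulIf (expf_neq0 d t00)); rewrite -/t0 mulrAC cross; ring.
have [B00|B00] := eqVneq B.[0] 0; last first.
  apply: (mulIf (_ : B.[0]^* != 0)); first by rewrite conjC_eq0.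
  by rewrite mulrAC cross mulrAC -realdir mulrAC.
rewrite B00 rmorph0 mulr0 in cross *.
have A00 : A.[0] != 0 by apply/eqP => A00; apply: AB0; rewrite A00 B00.
have /eqP := cross; rewrite eq_sym mulf_eq0 conjC_eq0 (negPf A00) => /eqP->.
by rewrite mulr0.
Qed.

(** * Real estimates *)

Lemma hev_norm_le (K : numDomainType) k (g : {poly K}) (x y r : K) :
  `|x| <= r -> `|y| <= r -> `|hev k g x y| <= (\sum_(i < k.+1) `|g`_i|) * r ^+ k.
Proof.
move=> xr yr; have r0 : 0 <= r := le_trans (normr_ge0 x) xr.
rewrite /hev mulr_suml; apply: le_trans (ler_norm_sum _ _ _) _; apply: ler_sum => i _.
have -> : r ^+ k = r ^+ i * r ^+ (k - i) by rewrite -exprD subnKC // -ltnS.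
by rewrite !normrM !normrX -mulrA ler_wpM2l // ler_pM ?exprn_ge0 ?lerXn2r ?nnegrE.
Qed.

(** The lower parts are at most M r^(D-1) once r >= 1, so delta r^D absorbs them beyond r = 1 + M /
    delta; below that radius they are bounded. *)
Lemma hsum_bounded_below (R : realFieldType) D (f : nat -> {poly R}) (delta : R) :
  0 < delta -> exists c0, forall x y,
    delta * (`|x| + `|y|) ^+ D <= hev D (f D) x y -> c0 <= hsum D f x y.
Proof.
move=> delta0; pose m k := \sum_(i < k.+1) `|(f k)`_i|.
have m0 k : 0 <= m k by rewrite sumr_ge0.
pose M := \sum_(k < D) m k; have M0 : 0 <= M by rewrite sumr_ge0.
pose b := 1 + M / delta.
have b1 : 1 <= b by rewrite lerDl divr_ge0 // ltW.
exists (- (M * b ^+ D)) => x y; set r := `|x| + `|y| => top_ge.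
have r0 : 0 <= r by rewrite addr_ge0.
have low k : `|hev k (f k) x y| <= m k * r ^+ k.
  by apply: hev_norm_le; rewrite ?lerDl ?lerDr.
have lowsum : - \sum_(k < D) m k * r ^+ k <= \sum_(k < D) hev k (f k) x y.
  rewrite -sumrN; apply: ler_sum => k _.
  by rewrite lerNl; apply: le_trans (low k); rewrite -normrN ler_norm.
rewrite /hsum big_ord_recr /=; apply: le_trans (lerD lowsum top_ge).
have [rb|br] := leP r b.
  apply: le_trans (_ : _ <= - \sum_(k < D) m k * r ^+ k) _; last first.
    by rewrite lerDl mulr_ge0 ?exprn_ge0 // ltW.
  rewrite lerN2 mulr_suml; apply: ler_sum => k _; apply: ler_wpM2l => //.
  apply: le_trans (_ : b ^+ k <= _); last by rewrite ler_weXn2l // ltnW.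
  by rewrite lerXn2r ?nnegrE // (le_trans r0).
apply: le_trans (_ : 0 <= _).
  by rewrite oppr_le0 mulr_ge0 // exprn_ge0 // (le_trans ler01).
rewrite addrC subr_ge0; case: D => [|D] in M M0 b b1 br lowsum {top_ge} *.
  by rewrite big_ord0 mulr_ge0 ?exprn_ge0 // ltW.
have r1 : 1 <= r := ltW (le_lt_trans b1 br).
apply: le_trans (_ : M * r ^+ D <= _).
  rewrite mulr_suml; apply: ler_sum => k _; apply: ler_wpM2l => //.
  by rewrite ler_weXn2l // -ltnS.
rewrite exprS mulrA ler_wpM2r ?exprn_ge0 // mulrC -ler_pdivrMr //.
by apply: ltW; apply: lt_trans br; rewrite ltrDr.
Qed.

Lemma hev_prod_XsubC (K : fieldType) (c : K) (rs : seq K) x y :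
  hev (size rs) (c *: \prod_(z <- rs) ('X - z%:P)) x y =
  c * \prod_(z <- rs) (x - z * y).
Proof.
have sz : (size (c *: \prod_(z <- rs) ('X - z%:P)) <= (size rs).+1)%N.
  by rewrite (leq_trans (size_scale_leq _ _)) // size_prod_XsubC.
have [->|y0] := eqVneq y 0.
  rewrite hev0r coefZ.
  have /monicP : \prod_(z <- rs) ('X - z%:P) \is monic := monic_prod_XsubC _ _ _.
  rewrite lead_coefE size_prod_XsubC /= => ->; rewrite mulr1; congr (_ * _).
  elim: rs {sz} => [|z rs IH]; first by rewrite big_nil.
  by rewrite big_cons exprS IH mulr0 subr0.
rewrite (hev_div _ sz y0) hornerZ horner_prod mulrCA; congr (_ * _).
elim: rs {sz} => [|z rs IH] /=; first by rewrite !big_nil mulr1.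
rewrite !big_cons -IH exprS hornerXsubC; field; exact: y0.
Qed.

Lemma norm_realc (R : rcfType) (x : R) : `|real_complex R x| = real_complex R `|x|.
Proof.
have [x0|x0] := ger0P x; first by rewrite ger0_norm ?ler0c.
by rewrite ltr0_norm ?rmorphN // -(rmorph0 (real_complex R)) ltcR.
Qed.

(** Subtracting from x - z y its conjugate leaves (conj z - z) y, which bounds y; then x is bounded
    as well. *)
Lemma nonreal_linear_coercive (K : numClosedFieldType) (z : K) : z^* != z ->
  exists2 delta, 0 < delta & forall x y, x \is Num.real -> y \is Num.real ->
    delta * (`|x| + `|y|) <= `|x - z * y|.
Proof.
move=> zR; have m0 : 0 < `|z^* - z| by rewrite normr_gt0 subr_eq0.
pose S := `|z^* - z| + 2 * (1 + `|z|).
have S0 : 0 < S by rewrite ltr_pwDl // mulr_ge0 // addr_ge0.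
exists (`|z^* - z| / S) => [|x y xR yR]; first by rewrite divr_gt0.
rewrite mulrAC ler_pdivrMr // [leRHS]mulrC.
have le_y : `|z^* - z| * `|y| <= 2 * `|x - z * y|.
  rewrite -normrM (_ : _ * y = (x - z * y) - (x - z * y)^*); last first.
    by rewrite rmorphB rmorphM /= (CrealP xR) (CrealP yR); ring.
  by apply: le_trans (ler_normB _ _) _; rewrite norm_conjC mulr_natl.
have le_x : `|x| <= `|x - z * y| + `|z| * `|y|.
  by rewrite -normrM -{1}[x](subrK (z * y)) ler_normD.
rewrite mulrDr; apply: le_trans (lerD (ler_wpM2l (ltW m0) le_x) le_y) _.
rewrite mulrDr mulrCA.
apply: le_trans (lerD (lerD (lexx _) (ler_wpM2l (normr_ge0 z) le_y)) (lexx _)) _.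
by rewrite le_eqVlt; apply/orP; left; apply/eqP; rewrite /S; ring.
Qed.

(** A positive form has only nonreal roots, so over [R[i]] it is a constant times a product of
    factors x - z y with z nonreal; the lower bounds of these factors multiply. *)
Lemma definite_form_coercive (R : rcfType) D (g : {poly R}) : (size g <= D.+1)%N ->
  (forall x y, (x, y) <> (0, 0) -> 0 < hev D g x y) ->
  exists2 delta, 0 < delta & forall x y, delta * (`|x| + `|y|) ^+ D <= hev D g x y.
Proof.
move=> sg pos; pose G := map_poly (real_complex R) g.
have gDpos : 0 < g`_D.
  have : (1, 0) <> (0, 0) :> R * R by case=> /eqP; rewrite oner_eq0.
  by move/pos; rewrite hev0r expr1n mulr1.
have gD := lt0r_neq0 gDpos.
have szg : size g = D.+1.
  by apply/eqP; rewrite eqn_leq sg ltnNge; apply: contraNN gD => /leq_sizeP->.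
have [rs DG] := closed_field_poly_normal G.
have lG : lead_coef G != 0.
  by rewrite lead_coef_map fmorph_eq0 lead_coefE szg.
have srs : size rs = D.
  have : size G = D.+1 by rewrite size_map_poly.
  by rewrite DG size_scale // size_prod_XsubC => -[].
have rsR z : z \in rs -> z^* != z.
  move=> zrs; apply/negP => /eqP/CrealP/complex_realP[a za].
  have : root (lead_coef G *: \prod_(z <- rs) ('X - z%:P)) z.
    by rewrite rootZ // root_prod_XsubC.
  rewrite -DG za /root horner_map fmorph_eq0 -(hev1r _ sg) gt_eqF // pos // => -[_ /eqP].
  by rewrite oner_eq0.
have [delta delta0 deltaP] : exists2 delta, 0 < delta &
    forall x y, x \is Num.real -> y \is Num.real ->
    delta * (`|x| + `|y|) ^+ size rs <= \prod_(z <- rs) `|x - z * y|.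
  elim: rs rsR {DG srs} => [|z rs IH] rsR.
    by exists 1 => // x y _ _; rewrite big_nil mulr1.
  have [|d1 d10 d1P] := IH; first by move=> w wrs; rewrite rsR // inE wrs orbT.
  have [d2 d20 d2P] := nonreal_linear_coercive (rsR z (mem_head _ _)).
  exists (d2 * d1) => [|x y xR yR]; first exact: mulr_gt0.
  rewrite big_cons /= exprS mulrACA ler_pM ?mulr_ge0 ?exprn_ge0 ?addr_ge0 ?d1P ?d2P //.
    exact: ltW.
  exact: ltW.
have [k kE] : exists k, `|lead_coef G| * delta = real_complex R k.
  by apply/complex_realP; rewrite realM ?normr_real // gtr0_real.
have k0 : 0 < k.
  by rewrite -ltcR -kE mulr_gt0 // normr_gt0.
exists k => // x y.
have hev_ge0 : 0 <= hev D g x y.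
  have [->|x0] := eqVneq x 0; last first.
    by apply/ltW/pos => -[/eqP]; rewrite (negPf x0).
  have [->|y0] := eqVneq y 0; last first.
    by apply/ltW/pos => -[/eqP]; rewrite (negPf y0).
  by rewrite hev0r mulr_ge0 ?exprn_ge0 // ltW.
rewrite -lecR !rmorphM /= rmorphXn rmorphD /= -!norm_realc -kE.
rewrite -[X in _ <= real_complex R X]ger0_norm // -norm_realc rmorph_hev /= -/G.
have -> X Y : hev D G X Y = lead_coef G * \prod_(z <- rs) (X - z * Y).
  by rewrite -hev_prod_XsubC srs -DG.
rewrite normrM normr_prod -mulrA ler_wpM2l // -srs.
by apply: deltaP; apply/complex_realP; eexists.
Qed.

(** A quantitative continuity at the origin, stable under sums and products and so available for
    forms. *)
Definition lip0 (K : numDomainType) (phi : K -> K -> K) : Prop :=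
  exists2 M, 0 <= M & forall a b eta, `|a| <= eta -> `|b| <= eta -> eta <= 1 ->
    `|phi a b - phi 0 0| <= M * eta.

Lemma lip0_cst (K : numDomainType) (c : K) : lip0 (fun _ _ => c).
Proof. by exists 0 => // a b eta _ _ _; rewrite subrr normr0 mul0r. Qed.

Lemma lip0D (K : numDomainType) (phi psi : K -> K -> K) :
  lip0 phi -> lip0 psi -> lip0 (fun a b => phi a b + psi a b).
Proof.
move=> [M M0 MP] [N N0 NP]; exists (M + N) => [|a b eta ae be e1].
  by rewrite addr_ge0.
rewrite opprD addrACA mulrDl; apply: le_trans (ler_normD _ _) (lerD _ _).
  exact: MP.
exact: NP.
Qed.

Lemma lip0M (K : numDomainType) (phi psi : K -> K -> K) :
  lip0 phi -> lip0 psi -> lip0 (fun a b => phi a b * psi a b).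
Proof.
move=> [M M0 MP] [N N0 NP].
exists ((`|phi 0 0| + M) * N + `|psi 0 0| * M) => [|a b eta ae be e1].
  by rewrite !(addr_ge0, mulr_ge0).
have e0 : 0 <= eta := le_trans (normr_ge0 a) ae.
have {}MP := MP a b eta ae be e1; have {}NP := NP a b eta ae be e1.
have phi_le : `|phi a b| <= `|phi 0 0| + M.
  rewrite -[phi a b](subrK (phi 0 0)) addrC (le_trans (ler_normD _ _)) // lerD2l.
  by rewrite (le_trans MP) // ler_piMr.
rewrite [X in `|X|](_ : _ = phi a b * (psi a b - psi 0 0) +
                            psi 0 0 * (phi a b - phi 0 0)); last by ring.
rewrite mulrDl -!mulrA; apply: le_trans (ler_normD _ _) (lerD _ _).
  by rewrite normrM ler_pM.
by rewrite normrM ler_wpM2l.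
Qed.

Lemma lip0_sum (K : numDomainType) (I : Type) (r : seq I) (phi : I -> K -> K -> K) :
  (forall i, lip0 (phi i)) -> lip0 (fun a b => \sum_(i <- r) phi i a b).
Proof.
move=> lphi; elim: r => [|i r IH].
  by exists 0 => // a b eta _ _ _; rewrite !big_nil subrr normr0 mul0r.
have [M M0 MP] := lip0D (lphi i) IH.
by exists M => // a b eta ae be e1; rewrite !big_cons; apply: MP.
Qed.

Lemma lip0_hev (K : numDomainType) k (g : {poly K}) (x y : K) :
  lip0 (fun a b => hev k g (x + a) (y + b)).
Proof.
have lx : lip0 (fun a b => x + a).
  by exists 1 => // a b eta ae _ _; rewrite addr0 addrAC subrr add0r mul1r.
have ly : lip0 (fun a b => y + b).
  by exists 1 => // a b eta _ be _; rewrite addr0 addrAC subrr add0r mul1r.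
have lX phi n : lip0 phi -> lip0 (fun a b => phi a b ^+ n : K).
  move=> lphi; elim: n => [|n [M M0 MP]].
    by exists 0 => // a b eta _ _ _; rewrite !expr0 subrr normr0 mul0r.
  have [N N0 NP] := lip0M lphi (ex_intro2 _ _ M M0 MP).
  by exists N => // a b eta ae be e1; rewrite !exprS; apply: NP.
apply: lip0_sum => i; apply: lip0M; last exact: lX.
by apply: lip0M; [apply: lip0_cst|apply: lX].
Qed.

Lemma neg_top_form_cone (R : realFieldType) D (f : nat -> {poly R}) (x y w : R) :
  (0 < D)%N -> hev D (f D) x y < 0 -> 0 <= w ->
  exists s, forall X Y, `|X - s * x| <= w -> `|Y - s * y| <= w -> hsum D f X Y < 0.
Proof.
case: D => // D _ neg w0; have [M M0 MP] := lip0_hev D.+1 (f D.+1) x y.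
pose r := `|x| + `|y| + 1.
have r1 : 1 <= r by rewrite lerDr addr_ge0.
pose m k := \sum_(i < k.+1) `|(f k)`_i|.
have m0 k : 0 <= m k by rewrite sumr_ge0.
pose L := \sum_(k < D.+1) m k * r ^+ D.
have r0 : 0 <= r := le_trans ler01 r1.
have L0 : 0 <= L by rewrite sumr_ge0 // => k _; rewrite mulr_ge0 ?exprn_ge0.
pose n := - hev D.+1 (f D.+1) x y.
have n0 : 0 < n by rewrite oppr_gt0.
(* With D now one less than the degree, F is at most s^D (L + M w - s n) on the box; the last
   summand makes this negative, and s >= w keeps the relative displacement w / s below 1. *)
pose s := 1 + w + (M * w + L) / n.
have q0 : 0 <= (M * w + L) / n by rewrite divr_ge0 ?addr_ge0 ?mulr_ge0 // ltW.
have s1 : 1 <= s by rewrite /s -addrA lerDl addr_ge0.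
have s0 : 0 < s := lt_le_trans ltr01 s1.
have ws : w <= s by rewrite /s [1 + w]addrC -addrA lerDl addr_ge0.
have sn : M * w + L < s * n.
  by rewrite /s mulrDl divfK ?lt0r_neq0 // ltrDr mulr_gt0 // ltr_pwDl.
exists s => X Y Xw Yw.
have sn0 := lt0r_neq0 s0.
pose a := (X - s * x) / s; pose b := (Y - s * y) / s.
have XE : X = s * (x + a) by rewrite /a; field.
have YE : Y = s * (y + b) by rewrite /b; field.
have aw : `|a| <= w / s by rewrite normrM normfV [`|s|]gtr0_norm // ler_pM2r ?invr_gt0.
have bw : `|b| <= w / s by rewrite normrM normfV [`|s|]gtr0_norm // ler_pM2r ?invr_gt0.
have ws1 : w / s <= 1 by rewrite ler_pdivrMr // mul1r.
have Xr : `|X| <= s * r.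
  rewrite XE normrM gtr0_norm // ler_pM2l // (le_trans (ler_normD _ _)) //.
  by rewrite /r -addrA lerD2l (le_trans aw) // (le_trans ws1) // lerDr.
have Yr : `|Y| <= s * r.
  rewrite YE normrM gtr0_norm // ler_pM2l // (le_trans (ler_normD _ _)) //.
  by rewrite /r [`|x| + _]addrC -addrA lerD2l (le_trans bw) // (le_trans ws1) // lerDr.
rewrite /hsum big_ord_recr /=.
have low : \sum_(k < D.+1) hev k (f k) X Y <= L * s ^+ D.
  rewrite mulr_suml; apply: ler_sum => k _.
  apply: le_trans (ler_norm _) _; apply: le_trans (hev_norm_le _ _ Xr Yr) _.
  rewrite -mulrA -/(m k) ler_wpM2l // exprMn mulrC.
  have kD : (k <= D)%N by rewrite -ltnS.
  by rewrite ler_pM ?exprn_ge0 ?ler_weXn2l // ltW.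
have top : hev D.+1 (f D.+1) X Y <= s ^+ D.+1 * (- n + M * (w / s)).
  rewrite XE YE hev_homog ler_pM2l ?exprn_gt0 // /n opprK -lerBlDl.
  apply: le_trans (ler_norm _) _; have := MP a b _ aw bw ws1.
  by rewrite !addr0.
apply: le_lt_trans (lerD low top) _.
rewrite exprSr -mulrA [L * _]mulrC -mulrDr pmulr_rlt0 ?exprn_gt0 //.
rewrite mulrDr mulrN [s * (M * _)]mulrCA [s * (w / s)]mulrC divfK //.
by rewrite addrCA addrC subr_lt0 addrC.
Qed.

(** The coefficient of index d gives the sign of [h] far out: reversal provides an explicit point
    1/eta with that sign, and the intermediate value theorem applies on [0, 1/eta]. *)
Lemma poly_pos_root (R : rcfType) (h : {poly R}) d : (size h <= d.+1)%N ->
  h.[0] * h`_d < 0 -> exists2 t, 0 < t & h.[t] = 0.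
Proof.
move=> sh sgn; have hd : (revp d h).[0] != 0.
  by rewrite revp_at0; apply: contraTneq sgn => ->; rewrite mulr0 ltxx.
have [M M0 MP] := horner_near0 (revp d h).
pose m := `|(revp d h).[0]|; have m0 : 0 < m by rewrite normr_gt0.
pose eta := m / (M + m); have Mm : 0 < M + m by rewrite ltr_wpDl.
have eta0 : 0 < eta by rewrite divr_gt0.
have eta1 : eta <= 1 by rewrite ler_pdivrMr // mul1r lerDr.
have near : `|(revp d h).[eta] - h`_d| < `|h`_d|.
  have := MP eta; rewrite gtr0_norm // => /(_ eta1); rewrite revp_at0.
  move/le_lt_trans; apply; rewrite -(revp_at0 d h) -/m.
  by rewrite -[ltRHS](divfK (lt0r_neq0 Mm)) -/eta mulrC ltr_pM2l // ltrDl.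
have etaV : 0 < eta^-1 by rewrite invr_gt0.
have sgn' : h.[0] * h.[eta^-1] < 0.
  rewrite horner_revp ?lt0r_neq0 // in near.
  have e0 : 0 < eta ^+ d by rewrite exprn_gt0.
  move: sgn near; rewrite ltr_norml; move: (h.[eta^-1]) (h`_d) (h.[0]) => p q z.
  have [q0|q0|->] := ltrgt0P q; last by rewrite mulr0 ltxx.
    rewrite pmulr_llt0 // => z0 /andP[lt_p _]; rewrite nmulr_rlt0 //.
    by rewrite -(pmulr_rgt0 _ e0); lra.
  rewrite nmulr_llt0 // => z0 /andP[_ lt_p]; rewrite pmulr_rlt0 //.
  by rewrite -(pmulr_rlt0 _ e0); lra.
have [t /itvP tI /rootP ht] := poly_ivtoo (ltW etaV) sgn'.
by exists t; rewrite ?tI.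
Qed.

(* The curve leaves in direction [v] and ends in direction [w], so one of the
   lines [R(v + w)], [R(v - w)] separates its two ends. *)
Lemma curve_crosses_line (R : rcfType) (a b : {poly R}) d v1 v2 w1 w2 l m :
  (size a <= d.+1)%N -> (size b <= d.+1)%N -> v1 * w2 != v2 * w1 ->
  l != 0 -> m != 0 -> a.[0] = l * v1 -> b.[0] = l * v2 ->
  a`_d = m * w1 -> b`_d = m * w2 ->
  exists2 t, 0 < t & exists s, (a.[t], b.[t]) = (s * (v1 + w1), s * (v2 + w2)) \/
                               (a.[t], b.[t]) = (s * (v1 - w1), s * (v2 - w2)).
Proof.
move=> sa sb det l0 m0 a0 b0 ad bd.
have nz p1 p2 : v1 * p2 != v2 * p1 -> (v1 + p1, v2 + p2) <> (0, 0).
  move=> dp [/eqP e1 /eqP e2]; move: dp; apply/negP; rewrite negbK.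
  move: e1 e2; rewrite !addr_eq0 => /eqP-> /eqP->; by rewrite !mulNr mulrC.
have main p1 p2 n : v1 * p2 != v2 * p1 -> a`_d = n * p1 -> b`_d = n * p2 ->
    0 < l * n -> exists2 t, 0 < t &
    exists s, (a.[t], b.[t]) = (s * (v1 + p1), s * (v2 + p2)).
  move=> dp ap bp ln.
  (* [h] vanishes exactly where (a, b) lies on the line R(v + p). The product of its value at 0 and
     its coefficient of index d is -l n det^2; if l m < 0, the choice p = -w restores a positive l
     n. *)
  pose h := (v2 + p2) *: a - (v1 + p1) *: b.
  have hE t : h.[t] = (v2 + p2) * a.[t] - (v1 + p1) * b.[t].
    by rewrite hornerD hornerN !hornerZ.
  have sh : (size h <= d.+1)%N.
    apply: leq_trans (size_polyD _ _) _; rewrite geq_max size_polyN.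
    by rewrite !(leq_trans (size_scale_leq _ _)).
  have [|t t0 ht] := poly_pos_root sh.
    rewrite hE coefB !coefZ a0 b0 ap bp.
    rewrite [X in X < _](_ : _ = - (l * n * (v1 * p2 - v2 * p1) ^+ 2)); last by ring.
    by rewrite oppr_lt0 mulr_gt0 // exprn_even_gt0 // subr_eq0.
  exists t => //; have nzt := nz _ _ dp.
  have [ab0|ab0] := eqVneq (a.[t], b.[t]) (0, 0).
    by exists 0; rewrite ab0 !mul0r.
  have [|s _ [sE1 sE2]] := det0_colinear nzt (elimN eqP ab0).
    by apply/eqP; rewrite -subr_eq0 -oppr_eq0 opprB [(v2 + p2) * _]mulrC
      [(v1 + p1) * _]mulrC mulrC [b.[t] * _]mulrC -hE ht.
  by exists s; rewrite sE1 sE2.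
have [lm|lm|lm] := ltrgt0P (l * m).
- have [t t0 [s sE]] := main w1 w2 m det ad bd lm.
  by exists t => //; exists s; left.
- have [||||t t0 [s sE]] := main (- w1) (- w2) (- m).
  + by rewrite !mulrN eqr_opp.
  + by rewrite mulrNN.
  + by rewrite mulrNN.
  + by rewrite mulrN oppr_gt0.
  by exists t => //; exists s; right.
by move/eqP: lm; rewrite mulf_eq0 (negPf l0) (negPf m0).
Qed.

Lemma real_valued_poly (R : rcfType) (p : {poly R[i]}) :
  (forall t, 0 < t -> p.[t] \is Num.real) ->
  exists q : {poly R}, p = map_poly (real_complex R) q.
Proof.
move=> pR; have pc : map_poly Num.conj p = p.
  apply: poly_eq_pos => t t0.
  have {1}-> : t = t^* by rewrite (CrealP _) // gtr0_real.
  by rewrite horner_map; apply/CrealP/pR.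
exists (\poly_(i < size p) complex.Re p`_i); apply/polyP=> i.
rewrite coef_map coef_poly; case: ltnP => [_|/(nth_default 0)->].
  rewrite /= RRe_real //; apply/CrealP.
  by rewrite -{2}pc coef_map.
by [].
Qed.

(** * Conclusion *)

Lemma hsum_trunc (K : comNzRingType) D m (f : nat -> {poly K}) x y :
  (forall k, (D < k)%N -> f k = 0) -> (D <= m)%N -> hsum m f x y = hsum D f x y.
Proof.
move=> f0 Dm; rewrite /hsum (big_ord_widen _ (fun k => hev k (f k) x y) (_ : D < m.+1)%N) //.
rewrite [LHS](bigID (fun k : 'I__ => (k < D.+1)%N)) /= [X in _ + X]big1 ?addr0 //.
move=> k; rewrite -ltnNge => /f0->.
by rewrite /hev big1 // => i _; rewrite coef0 !mul0r.
Qed.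

(** D is found over Q and serves every field at once, as the homogeneous parts above it vanish
    already over Q. *)
Lemma total_degree_exists (F : {poly {poly rat}}) (k0 : nat) : hpart F k0 != 0 ->
  exists D, [/\ hpart F D != 0, (k0 <= D)%N &
    forall (K : numFieldType) (x y : K),
      ev2 (polyQ2 K F) x y = hsum D (hpart (polyQ2 K F)) x y].
Proof.
move=> Fk0; have [M MP] := ev2_hsum F.
have [|k Fk|D FD Dmax] := @ex_maxnP (fun k => hpart F k != 0) M; first by exists k0.
  by rewrite leqNgt; apply: contra Fk => /ltnW/MP[->].
exists D; split=> // [|K x y]; first exact: Dmax.
have [m0 /(_ (maxn m0 D) (leq_maxl _ _))[_ ->]] := ev2_hsum (polyQ2 K F).
rewrite (hsum_trunc (D := D)) ?leq_maxr // => k Dk; rewrite hpart_polyQ2.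
have [->|/Dmax] := eqVneq (hpart F k) 0; first by rewrite rmorph0.
by rewrite leqNgt Dk.
Qed.

Lemma hsum_fmorph (K L : numFieldType) (phi : {rmorphism K -> L})
    (F : {poly {poly rat}}) D x y :
  phi (hsum D (hpart (polyQ2 K F)) x y) = hsum D (hpart (polyQ2 L F)) (phi x) (phi y).
Proof.
rewrite /hsum rmorph_sum; apply: eq_bigr => k _.
rewrite rmorph_hev !hpart_polyQ2 -map_poly_comp; congr (hev _ _ _ _).
by apply: eq_map_poly => q; rewrite /= fmorph_rat.
Qed.

(** The box of half-width N around s (x, y) contains a rational point of each class modulo N, and F
    < 0 on that box for a suitable s. *)
Lemma neg_top_form_weak_approx (R : realType) (F : {poly {poly rat}}) D (x y : R) :
  (0 < D)%N ->
  (forall (K : numFieldType) (a b : K),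
     ev2 (polyQ2 K F) a b = hsum D (hpart (polyQ2 K F)) a b) ->
  hev D (hpart (polyQ2 R F) D) x y < 0 ->
  weak_approx (fun a b : rat => ev2 (polyQ2 rat F) a b < 0).
Proof.
move=> D0 FE neg x0 y0 N N0.
have [s sP] := neg_top_form_cone D0 neg (ler0n R N).
have Np : 0 < (N%:R : R) by rewrite ltr0n.
have approx (a : R) (z : rat) : exists k : int,
    `|ratr (z + (N%:Z * k)%:~R) - a| <= N%:R.
  pose k := Num.floor ((a - ratr z) / N%:R); exists k.
  have := floor_itv ((a - ratr z) / N%:R); rewrite -/k.
  have -> : ratr (z + (N%:Z * k)%:~R) = ratr z + N%:R * k%:~R :> R.
    by rewrite rmorphD /= ratr_int intrM.
  rewrite ler_pdivlMr // ltr_pdivrMr // intrD mulrDl mul1r => /andP[le_k lt_k].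
  move: (ratr z) (k%:~R) (N%:R) le_k lt_k Np => u v w le_k lt_k w0.
  by rewrite ler_norml; apply/andP; split; lra.
have [k kP] := approx (s * x) x0; have [l lP] := approx (s * y) y0.
exists (x0 + (N%:Z * k)%:~R), (y0 + (N%:Z * l)%:~R); split; last first.
  by split; [exists k|exists l]; rewrite addrAC subrr add0r.
have := sP _ _ kP lP; move: (x0 + _) (y0 + _) => X Y.
by rewrite -(hsum_fmorph (ratr : {rmorphism rat -> R})) FE ltrq0.
Qed.

Lemma det_trans (K : fieldType) (e1 e2 a1 a2 b1 b2 : K) : (e1, e2) <> (0, 0) ->
  e1 * a2 = e2 * a1 -> e1 * b2 = e2 * b1 -> a1 * b2 = a2 * b1.
Proof.
move=> e0 ea eb; have [e10|e10] := eqVneq e1 0.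
  have e20 : e2 != 0 by apply/eqP => e20; apply: e0; rewrite e10 e20.
  have z u1 u2 : e1 * u2 = e2 * u1 -> u1 = 0.
    by rewrite e10 mul0r => /esym/eqP; rewrite mulf_eq0 (negPf e20) => /eqP.
  by rewrite (z _ _ ea) (z _ _ eb) mul0r mulr0.
apply: (mulfI e10); rewrite mulrCA eb [RHS]mulrA ea; ring.
Qed.

(** Each zero is the direction of one of the two ends, so among three zeros two share an end. *)
Lemma top_form_two_zeros (K : numClosedFieldType) D (f : nat -> {poly K}) (c : K)
    U A B e d (a1 a2 b1 b2 c1 c2 : K) :
  (0 < D)%N -> (forall k, (size (f k) <= k.+1)%N) -> f D != 0 ->
  Gm_param D f c U A B e d -> hev D (f D) a1 a2 = 0 -> hev D (f D) b1 b2 = 0 ->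
  hev D (f D) c1 c2 = 0 ->
  [\/ a1 * b2 = a2 * b1, a1 * c2 = a2 * c1 | b1 * c2 = b2 * c1].
Proof.
move=> D0 sf fD par za zb zc.
have [_ _ [E0 Ed] _ _] := par.
have zend x y : hev D (f D) x y = 0 ->
    A.[0] * y = B.[0] * x \/ A`_d * y = B`_d * x.
  move=> zxy; have [[-> ->]|/eqP ne] := eqVneq (x, y) (0, 0); first by left; rewrite !mulr0.
  exact: top_form_zero_end par ne zxy.
have [] := zend _ _ za; have [] := zend _ _ zb; have [] := zend _ _ zc => pc pb pa.
- by apply: Or31; apply: det_trans E0 _ _.
- by apply: Or31; apply: det_trans E0 _ _.
- by apply: Or32; apply: det_trans E0 _ _.
- by apply: Or33; apply: det_trans Ed _ _.
- by apply: Or33; apply: det_trans E0 _ _.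
- by apply: Or32; apply: det_trans Ed _ _.
- by apply: Or31; apply: det_trans Ed _ _.
- by apply: Or31; apply: det_trans Ed _ _.
Qed.

Lemma bounded_below_on_line (R : realFieldType) D (f : nat -> {poly R}) (e1 e2 : R) :
  (forall x y, 0 <= hev D (f D) x y) -> hev D (f D) e1 e2 != 0 ->
  exists c0, forall s, c0 <= hsum D f (s * e1) (s * e2).
Proof.
move=> pos nz; have gt0 : 0 < hev D (f D) e1 e2 by rewrite lt0r nz pos.
pose r := (`|e1| + `|e2|) ^+ D; have r0 : 0 <= r by rewrite exprn_ge0 // addr_ge0.
have [c0 c0P] := hsum_bounded_below D f (divr_gt0 gt0 (ltr_wpDl r0 ltr01)).
exists c0 => s; apply: c0P; rewrite hev_homog !normrM -mulrDr exprMn.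
(* The form is nonnegative at s e and positive at e, so homogeneity gives the sign of s^D even for
   negative s. *)
have s0 : 0 <= s ^+ D by rewrite -(pmulr_lge0 _ gt0) -hev_homog.
have -> : `|s| ^+ D = s ^+ D by rewrite -normrX ger0_norm.
rewrite mulrCA ler_wpM2l // -/r.
by rewrite mulrAC ler_pdivrMr ?ltr_wpDl // ler_pM2l // lerDl.
Qed.

Lemma fresh_below (R : realType) (bad : seq R[i]) (c0 : R) :
  exists2 c, c < c0 & real_complex R c \notin bad.
Proof.
elim: bad c0 => [|z bad IH] c0; first by exists (c0 - 1); rewrite // gtrBl.
have [c cc0 cbad] := IH (Num.min c0 (complex.Re z)).
move: cc0; rewrite lt_min => /andP[cc0 cz]; exists c => //.
rewrite inE negb_or cbad andbT; apply: contraTneq cz => <-.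
by rewrite ltxx.
Qed.

Local Notation rc := (real_complex _).

Lemma realc_pair_neq0 (R : rcfType) (x1 x2 : R) :
  (x1, x2) <> (0, 0) -> (rc x1, rc x2) <> (0, 0).
Proof.
move=> x0 E; apply: x0.
by rewrite (complexI (congr1 fst E)) (complexI (congr1 snd E)).
Qed.

Lemma realcJ (R : rcfType) (x : R) : (rc x)^* = rc x.
Proof. by apply: CrealP; apply/complex_realP; exists x. Qed.

(** Some zero q differs from v; its conjugate is again a zero, and is not v because v is real. As
    there are only two zeros, q is its own conjugate up to a factor, so it has a real
    representative. *)
Lemma real_zero_pair (R : realType) (F : {poly {poly rat}}) D (c : R[i]) U A B e d
    (v1 v2 : R) (r1 r2 s1 s2 : R[i]) :
  (0 < D)%N -> hpart F D != 0 ->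
  Gm_param D (hpart (polyQ2 R[i] F)) c U A B e d ->
  (v1, v2) <> (0, 0) -> hev D (hpart (polyQ2 R F) D) v1 v2 = 0 ->
  r1 * s2 != r2 * s1 ->
  hev D (hpart (polyQ2 R[i] F) D) r1 r2 = 0 ->
  hev D (hpart (polyQ2 R[i] F) D) s1 s2 = 0 ->
  exists w1 w2, v1 * w2 != v2 * w1 /\ hev D (hpart (polyQ2 R F) D) w1 w2 = 0.
Proof.
move=> D0 FD par v0 zv det zr zs.
have hevC x y : hev D (hpart (polyQ2 R[i] F) D) (rc x) (rc y) =
    rc (hev D (hpart (polyQ2 R F) D) x y).
  rewrite rmorph_hev !hpart_polyQ2 -map_poly_comp; congr (hev _ _ _ _).
  by apply: eq_map_poly => q; rewrite /= fmorph_rat.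
have v0C := realc_pair_neq0 v0.
have zvC : hev D (hpart (polyQ2 R[i] F) D) (rc v1) (rc v2) = 0.
  by rewrite hevC zv rmorph0.
have FDC : hpart (polyQ2 R[i] F) D != 0.
  by rewrite hpart_polyQ2 map_poly_eq0.
have [q1 [q2 [vq zq]]] : exists q1 q2, rc v1 * q2 != rc v2 * q1 /\
    hev D (hpart (polyQ2 R[i] F) D) q1 q2 = 0.
  have [vr|vr] := eqVneq (rc v1 * r2) (rc v2 * r1); last by exists r1, r2.
  exists s1, s2; split=> //; apply: contraNneq det => vs.
  by rewrite (det_trans v0C vr vs).
have zqc : hev D (hpart (polyQ2 R[i] F) D) q1^* q2^* = 0.
  have := congr1 Num.conj zq; rewrite rmorph_hev rmorph0 /=.
  by rewrite hpart_polyQ2 -map_poly_comp (eq_map_poly (fmorph_rat _)).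
have [||qq] := top_form_two_zeros D0 (size_hpart _) FDC par zvC zq zqc.
- by move/eqP; rewrite (negPf vq).
- move/(congr1 Num.conj); rewrite !rmorphM /= !conjCK !realcJ => /eqP.
  by rewrite (negPf vq).
have [q20|q20] := eqVneq q2 0.
  have q10 : q1 != 0 by apply: contraNneq vq => ->; rewrite q20 !mulr0.
  exists 1, 0; rewrite mulr0 mulr1 eq_sym; split.
    apply: contraNneq vq => ->; rewrite q20 mulr0 rmorph0 mul0r; exact: eqxx.
  apply: (fmorph_inj (real_complex R)); rewrite /= -hevC rmorph1 rmorph0.
  move: zq; rewrite q20 -[q1]mulr1 -[X in hev _ _ _ X](mulr0 q1) hev_homog.
  by move/eqP; rewrite mulf_eq0 expf_eq0 (negPf q10) andbF => /eqP.
have [w wE] : exists w, q1 / q2 = rc w.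
  apply/complex_realP/CrealP; rewrite fmorph_div /=.
  have q2c : q2^* != 0 by rewrite conjC_eq0.
  by apply: (mulIf q20); apply: (mulIf q2c); rewrite divfK // mulrAC divfK // qq mulrC.
exists w, 1; split.
  apply: contraNneq vq => /(congr1 (real_complex R)); rewrite !rmorphM rmorph1 /= mulr1 -wE => ->.
  by rewrite -mulrA divfK.
apply: (fmorph_inj (real_complex R)); rewrite /= -hevC rmorph1 rmorph0 -wE.
move: zq; rewrite (hev_div _ (size_hpart _ _) q20) hev1r ?size_hpart // => /eqP.
by rewrite mulf_eq0 expf_eq0 (negPf q20) andbF => /eqP.
Qed.

(** A real point yields, by [Gm_param_real], a whole real branch with ends along v and w; it would
    cross R(v + w) or R(v - w), where F > c. *)
Lemma no_low_real_point (R : realType) (F : {poly {poly rat}}) D (c : R) u A B e d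
    (v1 v2 w1 w2 x0 y0 : R) :
  Gm_param D (hpart (polyQ2 R[i] F)) (rc c) (ev2 u) A B e d ->
  v1 * w2 != v2 * w1 ->
  A.[0] * rc v2 = B.[0] * rc v1 ->
  A`_d * rc w2 = B`_d * rc w1 ->
  (forall s, c < hsum D (hpart (polyQ2 R F)) (s * (v1 + w1)) (s * (v2 + w2))) ->
  (forall s, c < hsum D (hpart (polyQ2 R F)) (s * (v1 - w1)) (s * (v2 - w2))) ->
  hsum D (hpart (polyQ2 R F)) x0 y0 <> c.
Proof.
move=> par det Av Bw lineP lineM Fxy.
have [[sA sB] _ [AB0 ABd] param _] := par.
have v0 : (v1, v2) <> (0, 0).
  by case=> v10 v20; move: det; rewrite v10 v20 !mul0r eqxx.
have w0 : (w1, w2) <> (0, 0).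
  by case=> w10 w20; move: det; rewrite w10 w20 !mulr0 eqxx.
have [l l0 [Al Bl]] : exists2 l, l != 0 & A.[0] = l * rc v1 /\ B.[0] = l * rc v2.
  by apply: det0_colinear (realc_pair_neq0 v0) AB0 _; rewrite mulrC -Av mulrC.
have [m m0 [Am Bm]] : exists2 m, m != 0 & A`_d = m * rc w1 /\ B`_d = m * rc w2.
  by apply: det0_colinear (realc_pair_neq0 w0) ABd _; rewrite mulrC -Bw mulrC.
have realdir : A.[0] * B.[0]^* = A.[0]^* * B.[0].
  by rewrite Al Bl !rmorphM /= !realcJ; ring.
have detC : A`_d * B.[0] != A.[0] * B`_d.
  rewrite Al Bl Am Bm mulrACA [X in _ != X]mulrACA [m * l]mulrC.
  rewrite (inj_eq (mulfI (mulf_neq0 l0 m0))) -!rmorphM /= (inj_eq (@complexI R)).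
  by rewrite eq_sym [w1 * _]mulrC.
have FxyC : hsum D (hpart (polyQ2 R[i] F)) (rc x0) (rc y0) = rc c.
  by rewrite -Fxy (hsum_fmorph (real_complex R)).
have isR (x : R) : rc x \is Num.real by apply/complex_realP; exists x.
have fR k : map_poly Num.conj (hpart (polyQ2 R[i] F) k) = hpart (polyQ2 R[i] F) k.
  by rewrite hpart_polyQ2 -map_poly_comp (eq_map_poly (fmorph_rat _)).
have [t0 t00 realt] := Gm_param_real fR (isR c) par realdir detC (isR x0) (isR y0) FxyC.
have te0 : t0 ^+ e != 0 by rewrite expf_neq0.
have rpoly (P : {poly R[i]}) : (size P <= d.+1)%N ->
    (forall t, 0 < t -> P.[t0 * t] / (t0 * t) ^+ e \is Num.real) ->
    exists q : {poly R}, [/\ (size q <= d.+1)%N, rc q.[0] = P.[0] / t0 ^+ e,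
      rc q`_d = P`_d * t0 ^+ d / t0 ^+ e &
      forall t, rc q.[t] = P.[t0 * rc t] / t0 ^+ e].
  (* As t^e is real for t > 0, dividing by the constant t0^e alone gives a polynomial with real
     values, hence with real coefficients. *)
  move=> sP PR; pose Q := (t0 ^+ e)^-1 *: dilp d t0 P.
  have QE t : Q.[t] = P.[t0 * t] / t0 ^+ e by rewrite hornerZ horner_dilp // mulrC.
  have [t t_gt0|q Dq] := @real_valued_poly _ Q.
    have tn0 : t ^+ e != 0 by rewrite expf_neq0 // lt0r_neq0.
    have -> : Q.[t] = P.[t0 * t] / (t0 * t) ^+ e * t ^+ e.
      by rewrite QE exprMn invfM mulrA divfK.
    by rewrite realM ?PR // rpredX // gtr0_real.
  exists q; split=> [|||t].
  - rewrite -(size_map_poly (real_complex R)) -Dq (leq_trans (size_scale_leq _ _)) //.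
    exact: size_poly.
  - by rewrite !horner_coef0 -coef_map -Dq coefZ coef_poly /= mulr1 mulrC.
  - by rewrite -coef_map -Dq coefZ coef_poly ltnSn mulrC.
  - by rewrite -horner_map -Dq QE.
have [a [sa a0 ad aE]] := rpoly A sA (fun t t_gt0 => (realt t t_gt0).1).
have [b [sb b0 bd bE]] := rpoly B sB (fun t t_gt0 => (realt t t_gt0).2).
have curve t : 0 < t -> hsum D (hpart (polyQ2 R F)) (a.[t] / t ^+ e) (b.[t] / t ^+ e) = c.
  move=> t_gt0; have tC : rc t != 0 by rewrite fmorph_eq0 lt0r_neq0.
  apply: (fmorph_inj (real_complex R)); rewrite (hsum_fmorph (real_complex R)).
  rewrite !fmorph_div !rmorphXn /= aE bE -!mulrA -!invfM -!exprMn.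
  by apply: (param _ _).1; rewrite mulf_neq0.
have colin (p1 p2 z1 z2 : R) (k : R[i]) : (z1, z2) <> (0, 0) -> k != 0 ->
    rc p1 = k * rc z1 -> rc p2 = k * rc z2 ->
    exists2 l, l != 0 & p1 = l * z1 /\ p2 = l * z2.
  move=> z0 k0 e1 e2; apply: det0_colinear => //.
    move=> [p10 p20]; apply: z0.
    have h (p z : R) : p = 0 -> rc p = k * rc z -> z = 0.
      move=> -> /esym/eqP; rewrite rmorph0 mulf_eq0 (negPf k0) fmorph_eq0.
      by move/eqP.
    by rewrite (h _ _ p10 e1) (h _ _ p20 e2).
  by apply: (fmorph_inj (real_complex R)); rewrite !rmorphM /= e1 e2; ring.
have [|||l' l'0 [al bl]] := colin a.[0] b.[0] v1 v2 (l / t0 ^+ e) v0.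
- by rewrite mulf_neq0 // invr_eq0.
- by rewrite a0 Al; ring.
- by rewrite b0 Bl; ring.
have [|||m' m'0 [am bm]] := colin a`_d b`_d w1 w2 (m * t0 ^+ d / t0 ^+ e) w0.
- by rewrite !mulf_neq0 ?invr_eq0 // expf_neq0.
- by rewrite ad Am; ring.
- by rewrite bd Bm; ring.
have [t t_gt0 [s]] := curve_crosses_line sa sb det l'0 m'0 al bl am bm.
by case=> -[ats bts]; have := curve t t_gt0; rewrite ats bts ![_ * _ / _]mulrAC;
  apply/eqP; rewrite gt_eqF.
Qed.

Lemma nonconstant_total_degree (R : numFieldType) (F : {poly {poly rat}}) (a b a' b' : R) :
  ev2 (polyQ2 R F) a b != ev2 (polyQ2 R F) a' b' ->
  exists D, [/\ hpart F D != 0, (0 < D)%N &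
    forall (K : numFieldType) (x y : K),
      ev2 (polyQ2 K F) x y = hsum D (hpart (polyQ2 K F)) x y].
Proof.
move=> ne; have [M MP] := ev2_hsum (polyQ2 R F).
have [|/existsPn allz] := boolP [exists k : 'I_M.+1, (0 < k)%N && (hpart F k != 0)].
  case/existsP=> k /andP[k0 Fk]; have [D [FD kD FE]] := total_degree_exists Fk.
  by exists D; split=> //; apply: leq_trans kD.
have cst x y : ev2 (polyQ2 R F) x y = (hpart (polyQ2 R F) 0)`_0.
  rewrite (MP M (leqnn M)).2 /hsum big_ord_recl [X in _ + X]big1 => [|k _].
    by rewrite addr0 /hev big_ord1 !expr0 !mulr1.
  have := allz (lift ord0 k); rewrite /= negbK => /eqP Fk.
  by rewrite /bump /= hpart_polyQ2 Fk rmorph0 /hev big1 // => i _; rewrite coef0 !mul0r.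
by case/eqP: ne; rewrite !cst.
Qed.

Unset Implicit Arguments.

Theorem mainTheorem14 (R : realType) (F : {poly {poly rat}}) :
  (* F(R x R) = R *)
  (forall r : R, exists x y : R, ev2 (polyQ2 R F) x y = r) ->
  (* for all but finitely many c in C, {F = c} is smooth and iso to A^1-{0} *)
  (exists bad : seq R[i], forall c : R[i], c \notin bad ->
      smooth_fiber (polyQ2 R[i] F) c /\ iso_Gm_fiber (polyQ2 R[i] F) c) ->
  (* C = {F = 0} is smooth (over Qbar) *)
  smooth_fiber (polyQ2 algC F) 0 ->
  (* C is isomorphic over Qbar to P^1 \ {a,b}, a, b in P^1(R), via phi,
     and the extension phi~ satisfies phi~(a) <> phi~(b) *)
  (exists (a b : algC * algC) (d : nat) (g0 g1 g2 : {poly algC})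
          (u : {poly {poly algC}}),
      [/\ [/\ nz2 a, nz2 b & ~ prop2 a b],
          [/\ a.1 \is Num.real, a.2 \is Num.real,
              b.1 \is Num.real & b.2 \is Num.real],
          phi_iso (polyQ2 algC F) a b d g0 g1 g2 u &
          ~ prop3 (hev d g0 a.1 a.2, hev d g1 a.1 a.2, hev d g2 a.1 a.2)
                  (hev d g0 b.1 b.2, hev d g1 b.1 b.2, hev d g2 b.1 b.2)]) ->
  weak_approx (fun x y : rat => ev2 (polyQ2 rat F) x y < 0).
Proof.
move=> surj [bad generic] _ [a [b [d [g0 [g1 [g2 [u [[nza nzb nab] _ iso ends]]]]]]]].
have [D [FD D0 FE]] : exists D, [/\ hpart F D != 0, (0 < D)%N &
    forall (K : numFieldType) (x y : K),
      ev2 (polyQ2 K F) x y = hsum D (hpart (polyQ2 K F)) x y].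
  have [x [y Fxy]] := surj 0; have [x' [y' Fxy']] := surj 1.
  apply: (@nonconstant_total_degree R F x y x' y').
  by rewrite Fxy Fxy' eq_sym oner_eq0.
pose fR := hpart (polyQ2 R F).
have [[x [y neg]]|nonneg] := EM (exists x y, hev D (fR D) x y < 0).
  exact: neg_top_form_weak_approx D0 FE neg.
have {}nonneg x y : 0 <= hev D (fR D) x y.
  by rewrite leNgt; apply/negP => neg; apply: nonneg; exists x, y.
exfalso.
have [p1 [p2 [q1 [q2 [det zp zq]]]]] :=
  phi_iso_top_form_zeros D0 (FE algC) nza nzb nab iso ends.
rewrite !hpart_polyQ2 in zp zq.
have [r1 [r2 [s1 [s2 [detC]]]]] :=
  rat_form_zeros_transfer R[i] FD (size_hpart F D) det zp zq.
rewrite -!hpart_polyQ2 => zr zs.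
have [[v1 [v2 [v0 zv]]]|noz] :=
    EM (exists v1 v2, (v1, v2) <> (0, 0) /\ hev D (fR D) v1 v2 = 0); last first.
  have [|delta delta0 coer] := definite_form_coercive (size_hpart (polyQ2 R F) D).
    move=> x y xy0; rewrite lt0r nonneg andbT; apply/eqP => z.
    by apply: noz; exists x, y.
  have [c0 c0P] := hsum_bounded_below D fR delta0.
  have [x [y Fxy]] := surj (c0 - 1); have := c0P x y (coer x y).
  by rewrite -FE Fxy lerBrDr gerDl lt_geF.
have param c : rc c \notin bad -> exists u A B e d,
    Gm_param D (hpart (polyQ2 R[i] F)) (rc c) (ev2 u) A B e d.
  by move=> /generic[_]; apply: iso_Gm_fiber_param; apply: FE.
have FDC : hpart (polyQ2 R[i] F) D != 0 by rewrite hpart_polyQ2 map_poly_eq0.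
have hevC x y : hev D (hpart (polyQ2 R[i] F) D) (rc x) (rc y) = rc (hev D (fR D) x y).
  rewrite rmorph_hev /fR !hpart_polyQ2 -map_poly_comp; congr (hev _ _ _ _).
  by apply: eq_map_poly => q; rewrite /= fmorph_rat.
(* One good level is enough to count the zeros of F_D, which do not depend on c. The level leading
   to the contradiction is chosen once the bounds on both lines are known. *)
have [c1 _ /param[u1 [A1 [B1 [e1 [d1 par1]]]]]] := fresh_below bad 0.
have [w1 [w2 [vw zw]]] := real_zero_pair D0 FD par1 v0 zv detC zr zs.
have zvC : hev D (hpart (polyQ2 R[i] F) D) (rc v1) (rc v2) = 0.
  by rewrite hevC zv rmorph0.
have zwC : hev D (hpart (polyQ2 R[i] F) D) (rc w1) (rc w2) = 0.
  by rewrite hevC zw rmorph0.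
have third z1 z2 : v1 * z2 != v2 * z1 -> w1 * z2 != w2 * z1 -> hev D (fR D) z1 z2 != 0.
  move=> vz wz; apply/eqP => zz.
  have zzC : hev D (hpart (polyQ2 R[i] F) D) (rc z1) (rc z2) = 0.
    by rewrite hevC zz rmorph0.
  have := top_form_two_zeros D0 (size_hpart _) FDC par1 zvC zwC zzC.
  rewrite -!(rmorphM (real_complex R)) => -[] /complexI/eqP; exact/negP.
have vw' : v1 * w2 - v2 * w1 != 0 by rewrite subr_eq0.
have [cP lineP] : exists c0, forall s, c0 <= hsum D fR (s * (v1 + w1)) (s * (v2 + w2)).
  apply: bounded_below_on_line => //; apply: third; rewrite -subr_eq0.
    by rewrite [X in X != 0](_ : _ = v1 * w2 - v2 * w1) //; ring.
  by rewrite [X in X != 0](_ : _ = - (v1 * w2 - v2 * w1)) ?oppr_eq0 //; ring.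
have [cM lineM] : exists c0, forall s, c0 <= hsum D fR (s * (v1 - w1)) (s * (v2 - w2)).
  apply: bounded_below_on_line => //; apply: third; rewrite -subr_eq0.
    by rewrite [X in X != 0](_ : _ = - (v1 * w2 - v2 * w1)) ?oppr_eq0 //; ring.
  by rewrite [X in X != 0](_ : _ = - (v1 * w2 - v2 * w1)) ?oppr_eq0 //; ring.
have [c] := fresh_below bad (Num.min cP cM).
rewrite lt_min => /andP[ccP ccM] /param[u2 [A [B [e [d2 par]]]]].
have [x [y]] := surj c; rewrite FE => Fxy.
have [_ _ [E0 Ed] _ _] := par.
have w0 : (w1, w2) <> (0, 0).
  by case=> w10 w20; move: vw; rewrite w10 w20 !mulr0 eqxx.
have vwC : rc v1 * rc w2 <> rc v2 * rc w1.
  by rewrite -!(rmorphM (real_complex R)) => /complexI/eqP; rewrite (negPf vw).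
have [vA|vA] := top_form_zero_end D0 (size_hpart _) FDC par (realc_pair_neq0 v0) zvC;
  have [wA|wA] := top_form_zero_end D0 (size_hpart _) FDC par (realc_pair_neq0 w0) zwC.
- by apply: vwC; apply: det_trans E0 vA wA.
- apply: (no_low_real_point par vw vA wA _ _ Fxy) => s.
    exact: lt_le_trans (lineP s).
  exact: lt_le_trans (lineM s).
(* The ends are exchanged: v and w swap roles, and R(w - v) is R(v - w) with s replaced by -s. *)
- have wv : w1 * v2 != w2 * v1 by rewrite eq_sym mulrC [w1 * _]mulrC.
  apply: (no_low_real_point par wv wA vA _ _ Fxy) => s.
    by rewrite [w1 + _]addrC [w2 + _]addrC; apply: lt_le_trans (lineP s).
  have := lineM (- s); rewrite !mulNr -!mulrN !opprB; exact: lt_le_trans.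
- by apply: vwC; apply: det_trans Ed vA wA.
Qed.
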